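(* Let $\mathcal{F}:\mathcal{C}\to\Omega$ be a quasi-Fitting invariant. Then there is a unique family $\{\mathcal{F}^{\langle n\rangle}:\mathcal{M}\to\Omega\}_{n\in\mathbb{Z}}$ of maps satisfying the following: \begin{itemize} \item $\mathcal{F}^{\langle0\rangle}$ is an extension of $\mathcal{F}:\mathcal{C}\to\Omega$. \item If $P\in\mathcal{Q}$, then $\mathcal{F}^{\langle n\rangle}(P)\in\Omega^\times$ for any $n\in\mathbb{Z}$. \item If $0\to N\to P\to M\to0$ is an exact sequence in $\mathcal{M}$ with $P\in\mathcal{Q}$, then $\mathcal{F}^{\langle n\rangle}(M)=\mathcal{F}^{\langle n\rangle}(P)\mathcal{F}^{\langle n-1\rangle}(N)$ for any $n\in\mathbb{Z}$. \item If $0\to M'\to M\to P\to0$ is an exact sequence in $\mathcal{M}$ with $P\in\mathcal{Q}$, then $\mathcal{F}^{\langle n\rangle}(M)=\mathcal{F}^{\langle n\rangle}(P)\mathcal{F}^{\langle n\rangle}(M')$ for any $n\in\mathbb{Z}$. \item If $0\to P\to M\to M'\to0$ is an exact sequence in $\mathcal{M}$ with $P\in\mathcal{Q}$, then $\mathcal{F}^{\langle n\rangle}(M)=\mathcal{F}^{\langle n\rangle}(P)\mathcal{F}^{\langle n\rangle}(M')$ for any $n\in\mathbb{Z}$. \end{itemize}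
   Context: $R$ is a (not necessarily commutative) left and right noetherian ring with unity, and $S$ is an Ore set of $R$ consisting of non-zero-divisors: $1\in S$; $S$ is closed under multiplication; for $f\in S$, $a\in R$ one has $fR\cap aS\ne\emptyset$ and $Rf\cap Sa\ne\emptyset$. Put $E^i_R(M)=\mathrm{Ext}^i_R(M,R)$ and $\mathrm{pd}^\star_R(M)=\sup\{i\in\mathbb Z\mid E^i_R(M)\ne0\}$. It is assumed that there is an integer $d(R)$ with $\mathrm{pd}^\star_R(M)\le d(R)$ for every finitely generated left or right $R$-module $M$. $\mathcal M$ is the category of finitely generated $S$-torsion left $R$-modules ($S$-torsion: every element is annihilated by an element of $S$); $\mathcal C=\{M\in\mathcal M\mid\mathrm{pd}^\star_R(M)\le1\}$; $\mathcal P=\{P\in\mathcal M\mid\mathrm{pd}_R(P)\le1\}$; $\mathcal Q=\{M\in\mathcal M\mid\mathrm{pd}_R(M)<\infty\}$ (the zero module has $\mathrm{pd}_R=-\infty$). A quasi-Fitting invariant is a map $\mathcal F$ assigning to each object of $\mathcal C$ an element of a commutative monoid $\Omega$ such that: (i) $\mathcal F(P)\in\Omega^\times$ for $P\in\mathcal P$; (ii) if $0\to M'\to M\to P\to0$ is exact in $\mathcal C$ with $P\in\mathcal P$, then $\mathcal F(M)=\mathcal F(P)\mathcal F(M')$; (iii) if $0\to P\to M\to M'\to0$ is exact in $\mathcal C$ with $P\in\mathcal P$, then $\mathcal F(M)=\mathcal F(P)\mathcal F(M')$. *)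

(* Defs.v *)
From HB Require Import structures.
From mathcomp Require Import all_boot all_order all_algebra.
Set Implicit Arguments.
Unset Strict Implicit.
Unset Printing Implicit Defensive.
Import GRing.Theory.
Local Open Scope ring_scope.

(** Left [R]-modules are [lmodType R]; right [R]-modules are left modules over
    the converse ring, [lmodType R^c].  [pzRingType] allows the zero ring. *)

Definition left_ideal (R : pzRingType) (I : R -> Prop) : Prop :=
  [/\ I 0, forall x y, I x -> I y -> I (x + y) & forall a x, I x -> I (a * x)].

Definition left_noetherian (R : pzRingType) : Prop :=
  forall I : R -> Prop, left_ideal I ->
  exists (n : nat) (v : 'I_n -> R),
    forall x, I x <-> exists c : 'I_n -> R, x = \sum_(i < n) c i * v i.

Definition right_noetherian (R : pzRingType) : Prop := left_noetherian R^c.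

Definition non_zero_divisor (R : pzRingType) (f : R) : Prop :=
  GRing.lreg f /\ GRing.rreg f.

Record ore_set (R : pzRingType) (S : R -> Prop) : Prop := OreSet {
  ore_one : S 1;
  ore_mul : forall f g, S f -> S g -> S (f * g);
  ore_right : forall f a, S f -> exists r s, S s /\ f * r = a * s;
  ore_left : forall f a, S f -> exists r s, S s /\ r * f = s * a
}.

Section Modules.
Context {R : pzRingType}.
Implicit Types M N P A B : lmodType R.

Definition finitely_generated M : Prop :=
  exists (n : nat) (v : 'I_n -> M),
    forall x, exists c : 'I_n -> R, x = \sum_(i < n) c i *: v i.

Definition torsion (S : R -> Prop) M : Prop :=
  forall x : M, exists s : R, S s /\ s *: x = 0.

Definition surjective (U V : Type) (f : U -> V) : Prop :=
  forall y, exists x, f x = y.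

Definition exact_at A B N (f : {linear A -> B}) (g : {linear B -> N}) : Prop :=
  forall y : B, g y = 0 <-> exists x : A, f x = y.

Definition short_exact A B N (f : {linear A -> B}) (g : {linear B -> N}) : Prop :=
  [/\ injective f, exact_at f g & surjective g].

Definition projective P : Prop :=
  forall A B (p : {linear A -> B}) (f : {linear P -> B}), surjective p ->
  exists g : {linear P -> A}, forall x, p (g x) = f x.

(** [... -> res_obj 1 -> res_obj 0 -> M -> 0] *)
Record proj_resolution M := ProjResolution {
  res_obj : nat -> lmodType R;
  res_d : forall i, {linear res_obj i.+1 -> res_obj i};
  res_aug : {linear res_obj 0%N -> M};
  res_proj : forall i, projective (res_obj i);
  res_aug_surj : surjective res_aug;
  res_exact0 : exact_at (res_d 0%N) res_aug;
  res_exact : forall i, exact_at (res_d i.+1) (res_d i)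
}.

(** Cocycles and coboundaries of the cochain complex [i |-> Hom_R(P_i, N)]. *)
Definition cocycle M N (P : proj_resolution M) (i : nat)
    (f : {linear res_obj P i -> N}) : Prop :=
  forall x, f (res_d P i x) = 0.

Definition coboundary M N (P : proj_resolution M) (i : nat) :
    {linear res_obj P i -> N} -> Prop :=
  match i with
  | 0%N => fun f => forall x, f x = 0
  | j.+1 => fun f =>
      exists g : {linear res_obj P j -> N}, forall x, f x = g (res_d P j x)
  end.

(** [Ext^i_R(M, N) = 0]: the [i]-th cohomology of [Hom_R(P_*, N)] vanishes.
    It does not depend on the resolution, and free resolutions always exist, so
    quantifying universally over [P] is not vacuous. *)
Definition Ext_zero (i : nat) M N : Prop :=
  forall (P : proj_resolution M) (f : {linear res_obj P i -> N}),
    cocycle f -> coboundary f.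

(** [E^i_R(M) = 0], where [E^i_R(M) = Ext^i_R(M, R)]. *)
Definition E_zero (i : nat) M : Prop := Ext_zero i M R^o.

(** [pd*_R(M) <= d], i.e. [d] bounds every [i] with [E^i_R(M) <> 0]; negative
    degrees, where [E^i] is zero, contribute nothing. *)
Definition pdstar_le M (d : int) : Prop :=
  forall i : nat, ~ E_zero i M -> i%:Z <= d.

(** [pd_R(M) <= n]; it holds for every [n] when [M] is zero, in accordance with
    [pd_R(0) = -oo]. *)
Definition pd_le M (n : nat) : Prop :=
  exists P : proj_resolution M,
    forall i, (n < i)%N -> forall x : res_obj P i, x = 0.

Definition pd_finite M : Prop := exists n, pd_le M n.

End Modules.

Definition pdstar_bounded (R : pzRingType) : Prop :=
  exists d : int,
    (forall M : lmodType R, finitely_generated M -> pdstar_le M d) /\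
    (forall M : lmodType R^c, finitely_generated M -> pdstar_le M d).

Record catM (R : pzRingType) (S : R -> Prop) := CatM {
  catM_mod :> lmodType R;
  catM_fg : finitely_generated catM_mod;
  catM_torsion : torsion S catM_mod
}.

Record catC (R : pzRingType) (S : R -> Prop) := CatC {
  catC_obj :> catM S;
  catC_pdstar : pdstar_le catC_obj 1
}.

Definition inP (R : pzRingType) (S : R -> Prop) (P : catM S) : Prop := pd_le P 1.

Definition inQ (R : pzRingType) (S : R -> Prop) (P : catM S) : Prop := pd_finite P.

Definition invertible (Omega : monoidType) (x : Omega) : Prop :=
  exists y : Omega, (x * y = 1)%g /\ (y * x = 1)%g.

(** [inP P] implies [pdstar_le P 1], so letting [P] range over the objects of
    [catC] satisfying [inP] covers all of [P]. *)
Record quasi_fitting (R : pzRingType) (S : R -> Prop) (Omega : monoidType)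
    (F : catC S -> Omega) : Prop := QuasiFitting {
  qf_unit : forall P : catC S, inP P -> invertible (F P);
  qf_quot : forall (M' M P : catC S) (f : {linear M' -> M}) (g : {linear M -> P}),
    inP P -> short_exact f g -> F M = (F P * F M')%g;
  qf_sub : forall (P M M' : catC S) (f : {linear P -> M}) (g : {linear M -> M'}),
    inP P -> short_exact f g -> F M = (F P * F M')%g
}.

Record shift_family (R : pzRingType) (S : R -> Prop) (Omega : monoidType)
    (F : catC S -> Omega) (Fn : int -> catM S -> Omega) : Prop := ShiftFamily {
  sf_extends : forall M : catC S, Fn 0 M = F M;
  sf_unit : forall P : catM S, inQ P -> forall n, invertible (Fn n P);
  sf_shift : forall (N P M : catM S) (f : {linear N -> P}) (g : {linear P -> M}),
    inQ P -> short_exact f g -> forall n, Fn n M = (Fn n P * Fn (n - 1) N)%g;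
  sf_quot : forall (M' M P : catM S) (f : {linear M' -> M}) (g : {linear M -> P}),
    inQ P -> short_exact f g -> forall n, Fn n M = (Fn n P * Fn n M')%g;
  sf_sub : forall (P M M' : catM S) (f : {linear P -> M}) (g : {linear M -> M'}),
    inQ P -> short_exact f g -> forall n, Fn n M = (Fn n P * Fn n M')%g
}.

(* Main.v *)
(** Every [M] in [catM S] is the cokernel of some [N -> P] with [P] a finite direct sum
    of modules [R / R s], [s] in [S], so that [pd P <= 1], and then [pd* N < pd* M] as long
    as [pd* M > 1].  If moreover [pd* M <= 1], duality embeds [M] into such a [P] with
    cokernel again in [catC S].  The shift rule forces
    [F^<n>(M) = F^<n-1>(P)^-1 F^<n-1>(N)], since it gives [F^<n>(P) F^<n-1>(P) = 1].
    Read from right to left and from left to right it computes [F^<n>] on [catC S] for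
    [n >= 0] and for [n <= 0]; applied [d] more times from right to left, it reaches all of
    [catM S] from [F^<n-d>] on [catC S].  Two covers of [M] are compared through their fibre
    product over [M], and two embeddings through their pushout, which gives well-definedness;
    the multiplicativity rules follow from the same diagrams. *)

From HB Require Import structures.
From mathcomp Require Import all_boot all_order all_algebra.
From mathcomp Require Import boolp functions.
Require Import Defs.
Set Implicit Arguments.
Unset Strict Implicit.
Unset Printing Implicit Defensive.
Import Order.TTheory GRing.Theory Num.Theory.
Local Open Scope ring_scope.

(** * Submodules and quotients *)

(** The obstacle is range: at each stage a map is controlled only on the modules with pd* <= k. All
    maps are therefore total on [catM S], and [fitting k] states the rules on that range alone. A
    shift up widens the range from k to k+1, while a shift down stays at k = 1, where embeddings are
    available; hence a separate start at index n - d for each n, and the need to show that the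
    starting index is immaterial. Embedding relies on the bound for right modules. If M = F / K with
    F free and pd* M <= 1, then Ext^i(K, R) = 0 for all i > 0, so dualizing keeps the syzygy
    sequences of K exact, and Ext^1(Hom(K, R), R) vanishes by dimension shifting. This makes K
    reflexive, in place of the finite projective dimension that K need not have. Ext is recast as a
    recursion on syzygies, so that long exact sequences reduce to diagrams of short ones. *)

Definition mklin (R : pzRingType) (U V : lmodType R) (f : U -> V)
    (fL : linear f) : {linear U -> V} :=
  HB.pack f (GRing.isLinear.Build R U V *:%R f fL).

Record submodule (R : pzRingType) (M : lmodType R) := Submodule {
  sm_pred :> M -> Prop;
  sm_zero : sm_pred 0;
  sm_lin : forall a x y, sm_pred x -> sm_pred y -> sm_pred (a *: x + y)
}.

Section SubModule.
Context {R : pzRingType} {M : lmodType R} (U : submodule M).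

Lemma smD x y : U x -> U y -> U (x + y).
Proof. by move=> Ux Uy; rewrite -[x]scale1r; apply: sm_lin. Qed.

Lemma smZ a x : U x -> U (a *: x).
Proof. by move=> Ux; rewrite -[_ *: _]addr0; apply: sm_lin => //; apply: sm_zero. Qed.

Lemma smN x : U x -> U (- x).
Proof. by move=> Ux; rewrite -scaleN1r; apply: smZ. Qed.

Lemma smB x y : U x -> U y -> U (x - y).
Proof. by move=> Ux Uy; apply: smD => //; apply: smN. Qed.

Lemma sm_sum I (r : seq I) (F : I -> M) : (forall i, U (F i)) -> U (\sum_(i <- r) F i).
Proof.
by move=> UF; elim/big_ind: _ => //; [apply: sm_zero|move=> *; apply: smD].
Qed.

Definition sm_bool : pred M := fun x => `[< U x >].

Lemma sm_bool_closed : submod_closed sm_bool.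
Proof.
split; first exact/asboolP/sm_zero.
by move=> a x y /asboolP Ux /asboolP Uy; apply/asboolP/sm_lin.
Qed.

HB.instance Definition _ := GRing.isSubmodClosed.Build R M sm_bool sm_bool_closed.

Definition subm_type : Type := {x : M | sm_bool x}.
HB.instance Definition _ := SubType.on subm_type.
HB.instance Definition _ := [Choice of subm_type by <:].
HB.instance Definition _ := [SubChoice_isSubZmodule of subm_type by <:].
HB.instance Definition _ := [SubZmodule_isSubLmodule of subm_type by <:].

Definition subm : lmodType R := GRing.Lmodule.clone R subm_type _.

Lemma val_subm_linear : linear (val : subm -> M).
Proof. by move=> a x y; rewrite linearP. Qed.

(* The opaque [smval_key] and [qpi_key] keep [/=] from unfolding [smval] and [qpi]. *)
Fact smval_key : {f : {linear subm -> M} | f =1 val}.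
Proof. by exists (mklin val_subm_linear). Qed.

Definition smval : {linear subm -> M} := sval smval_key.

Lemma smval_in x : U (smval x).
Proof. by rewrite /smval (svalP smval_key); apply/asboolP/(valP x). Qed.

Lemma smval_inj : injective smval.
Proof. by move=> x y; rewrite /smval !(svalP smval_key); apply: val_inj. Qed.

Lemma smval_ex x : U x -> exists y, smval y = x.
Proof.
move=> Ux; have Ub : sm_bool x by apply/asboolP.
by exists (exist _ x Ub); rewrite /smval (svalP smval_key).
Qed.

Definition sm_zmod : zmodClosed M := GRing.ZmodClosed.clone M sm_bool _.

Definition quom_type : Type := Quotient.quot sm_zmod.
HB.instance Definition _ := GRing.Zmodule.on quom_type.

Definition qproj : M -> quom_type := fun x => (\pi_(Quotient.quot sm_zmod) x)%qT.

Lemma qproj_eq x y : qproj x = qproj y <-> U (x - y).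
Proof.
rewrite /qproj; split => [/eqmodP|Uxy]; first by move=> /asboolP.
by apply/eqmodP/asboolP.
Qed.

Lemma qprojD x y : qproj (x + y) = qproj x + qproj y.
Proof. by rewrite /qproj -(raddfD (\pi_(Quotient.quot sm_zmod))%qT). Qed.

Lemma qproj_surj q : exists x, qproj x = q.
Proof. by exists (repr (q : Quotient.quot sm_zmod)); rewrite /qproj reprK. Qed.

Definition qscale (a : R) (q : quom_type) : quom_type :=
  qproj (a *: repr (q : Quotient.quot sm_zmod)).

Lemma qscaleE a x : qscale a (qproj x) = qproj (a *: x).
Proof.
apply/qproj_eq; rewrite -scalerBr; apply: smZ; apply/qproj_eq.
by rewrite {1}/qproj reprK.
Qed.

Fact qscaleA a b q : qscale a (qscale b q) = qscale (a * b) q.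
Proof. by have [x <-] := qproj_surj q; rewrite !qscaleE scalerA. Qed.
Fact qscale1 : left_id 1 qscale.
Proof. by move=> q; have [x <-] := qproj_surj q; rewrite !qscaleE scale1r. Qed.
Fact qscaleDr : right_distributive qscale +%R.
Proof.
move=> a q q'; have [x <-] := qproj_surj q; have [y <-] := qproj_surj q'.
by rewrite -qprojD !qscaleE scalerDr qprojD.
Qed.
Fact qscaleDl q : {morph qscale^~ q : a b / a + b}.
Proof. by move=> a b; have [x <-] := qproj_surj q; rewrite !qscaleE scalerDl qprojD. Qed.

HB.instance Definition _ :=
  GRing.Zmodule_isLmodule.Build R quom_type qscaleA qscale1 qscaleDr qscaleDl.

Definition quom : lmodType R := GRing.Lmodule.clone R quom_type _.

Lemma qproj_linear : linear (qproj : M -> quom).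
Proof. by move=> a x y; rewrite qprojD -qscaleE. Qed.

Fact qpi_key : {f : {linear M -> quom} | f =1 qproj}.
Proof. by exists (mklin qproj_linear). Qed.

Definition qpi : {linear M -> quom} := sval qpi_key.

Lemma qpi_surj : surjective qpi.
Proof. by move=> q; have [x <-] := qproj_surj q; exists x; rewrite /qpi (svalP qpi_key). Qed.

Lemma qpi_eq0 x : qpi x = 0 <-> U x.
Proof.
have qpiE := svalP qpi_key; rewrite -(linear0 qpi).
by rewrite -{2}[x]subr0 /qpi !qpiE qproj_eq.
Qed.

End SubModule.

(** * Linear maps from relations, kernels, images and factorizations *)

Section Maps.
Context {R : pzRingType}.
Implicit Types A B C M N : lmodType R.

(** Maps out of a quotient or into a submodule are given by a relation, with no representative to
    choose: by linearity, single-valuedness reduces to its case at 0. *)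
Lemma linear_of_rel A B (r : A -> B -> Prop) :
  (forall x, exists y, r x y) ->
  (forall a x y x' y', r x y -> r x' y' -> r (a *: x + x') (a *: y + y')) ->
  (forall y, r 0 y -> y = 0) ->
  exists f : {linear A -> B}, forall x y, r x y -> f x = y.
Proof.
move=> r_ex r_lin r0.
have r_fun x y y' : r x y -> r x y' -> y = y'.
  move=> rxy rxy'; have := r_lin (-1) _ _ _ _ rxy rxy'.
  by rewrite !scaleN1r addNr => /r0 /eqP; rewrite addrC subr_eq0 => /eqP.
have [f fP] := choice r_ex.
have fL : linear f by move=> a x y; apply: r_fun (fP _) (r_lin _ _ _ _ _ (fP x) (fP y)).
by exists (mklin fL) => x y; apply: r_fun (fP x).
Qed.

Definition kerm A B (f : {linear A -> B}) : submodule A.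
Proof.
exists (fun x => f x = 0); first exact: linear0.
by move=> a x y fx fy; rewrite linearP fx fy scaler0 addr0.
Defined.

Definition imm A B (f : {linear A -> B}) : submodule B.
Proof.
exists (fun y => exists x, f x = y); first by exists 0; rewrite linear0.
by move=> a _ _ [x <-] [y <-]; exists (a *: x + y); rewrite linearP.
Defined.

Lemma short_exact_ker A B (f : {linear A -> B}) :
  surjective f -> short_exact (smval (kerm f)) f.
Proof.
move=> fS; split=> //; first exact: smval_inj.
by move=> y; split=> [fy|[x <-]]; [exact: smval_ex|exact: (smval_in x)].
Qed.

Lemma short_exact_coker A B (f : {linear A -> B}) :
  injective f -> short_exact f (qpi (imm f)).
Proof. by move=> fI; split=> //; [move=> y; rewrite qpi_eq0|exact: qpi_surj]. Qed.

Lemma linear_inj A B (f : {linear A -> B}) : (forall x, f x = 0 -> x = 0) -> injective f.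
Proof.
move=> f0 x y fxy; apply/eqP; rewrite -subr_eq0; apply/eqP/f0.
by rewrite linearB /= fxy subrr.
Qed.

Lemma inj_eq0 A B (f : {linear A -> B}) x : injective f -> f x = 0 -> x = 0.
Proof. by move=> fI fx; apply: fI; rewrite fx linear0. Qed.

Lemma factor_surj A B C (p : {linear A -> B}) (f : {linear A -> C}) :
  surjective p -> (forall x, p x = 0 -> f x = 0) ->
  exists g : {linear B -> C}, forall x, g (p x) = f x.
Proof.
move=> pS pf; pose r y z := exists x, p x = y /\ f x = z.
have [|||g gP] := @linear_of_rel _ _ r.
- by move=> y; have [x <-] := pS y; exists (f x), x.
- move=> a _ _ _ _ [x [<- <-]] [x' [<- <-]].
  by exists (a *: x + x'); rewrite !linearP.
- by move=> _ [x [/pf fx <-]].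
by exists g => x; apply: gP; exists x.
Qed.

Lemma factor_inj A B C (i : {linear A -> B}) (f : {linear C -> B}) :
  injective i -> (forall x, exists y, i y = f x) ->
  exists g : {linear C -> A}, forall x, i (g x) = f x.
Proof.
move=> iI if_; have [|||g gP] := @linear_of_rel _ _ (fun x y => i y = f x).
- exact: if_.
- by move=> a x y x' y' e e'; rewrite !linearP e e'.
- by move=> y; rewrite linear0; apply: inj_eq0.
by exists g => x; have [y ify] := if_ x; rewrite (gP _ _ ify).
Qed.
End Maps.

(** * Exact sequences and free modules *)

Section Exact.
Context {R : pzRingType}.
Implicit Types A B C K M N P V X Y Z : lmodType R.

Lemma lift_subm A M (U : submodule M) (f : {linear A -> M}) :
  (forall x, U (f x)) -> exists g : {linear A -> subm U}, forall x, smval U (g x) = f x.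
Proof.
by move=> Uf; apply: factor_inj => [|x]; [exact: smval_inj|exact: smval_ex].
Qed.

Lemma exact0 A B C (f : {linear A -> B}) (g : {linear B -> C}) x :
  short_exact f g -> g (f x) = 0.
Proof. by case=> _ fg _; apply/fg; exists x. Qed.

(** [Z] is the preimage of [A] in [P], that is, the kernel of [P -> M -> C]. *)
Lemma ses_preimage N P M A C (j : {linear N -> P}) (q : {linear P -> M})
    (i : {linear A -> M}) (p : {linear M -> C}) :
  short_exact j q -> short_exact i p ->
  exists Z (a : {linear Z -> P}) (b : {linear N -> Z}) (c : {linear Z -> A}),
    [/\ short_exact a (p \o q), short_exact b c,
        (forall x, a (b x) = j x) & forall z, i (c z) = q (a z)].
Proof.
move=> jq ip; have [jI jqE qS] := jq; have [iI ipE pS] := ip.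
have pqS : surjective (p \o q).
  by move=> y; have [m <-] := pS y; have [x <-] := qS m; exists x.
pose U := kerm (p \o q).
have [b bE] : exists b : {linear N -> subm U}, forall x, smval U (b x) = j x.
  by apply: lift_subm => x /=; rewrite (exact0 _ jq) linear0.
have [c cE] : exists c : {linear subm U -> A}, forall x, i (c x) = (q \o smval U) x.
  by apply: factor_inj => // z; apply/ipE; apply: (smval_in z).
exists (subm U), (smval U), b, c; split=> //; first exact: short_exact_ker.
split.
- by apply: linear_inj => x bx; apply: (inj_eq0 jI); rewrite -bE bx linear0.
- move=> z; split=> [cz|[x <-]].
    have /jqE [x jx] : q (smval U z) = 0 by rewrite -[LHS]cE cz linear0.
    by exists x; apply: (@smval_inj _ _ U); rewrite bE.
  by apply: (inj_eq0 iI); rewrite cE /= bE (exact0 _ jq).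
- move=> y; have [x qx] := qS (i y).
  have Ux : U x by rewrite /= qx (exact0 _ ip).
  have [z zx] := smval_ex Ux; exists z; apply: iI.
  by rewrite cE /= zx.
Qed.

(** [X] is the fibre product of [B] and [V] over [C]. The last clause serves when [g] is a second
    cover of [C]: its kernel is then also that of [h]. *)
Lemma ses_pullback A B C V (i : {linear A -> B}) (p : {linear B -> C})
    (g : {linear V -> C}) :
  short_exact i p ->
  exists X (i' : {linear A -> X}) (p' : {linear X -> V}) (h : {linear X -> B}),
    [/\ short_exact i' p', forall x, h (i' x) = i x,
        forall x, p (h x) = g (p' x) &
        forall K (k : {linear K -> V}), short_exact k g ->
          exists k' : {linear K -> X}, short_exact k' h /\ forall x, p' (k' x) = k x].
Proof.
move=> ip; have [iI ipE pS] := ip.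
have UL : forall a (x y : (B * V)%type), p x.1 = g x.2 -> p y.1 = g y.2 ->
  p (a *: x + y).1 = g (a *: x + y).2.
  by move=> a x y ex ey; rewrite /= !linearP ex ey.
have U0 : p (0 : (B * V)%type).1 = g (0 : (B * V)%type).2 by rewrite /= !linear0.
pose U := Submodule U0 UL.
have sv (x : subm U) : p (smval U x).1 = g (smval U x).2 by apply: (smval_in x).
have hL : linear (fun x : subm U => (smval U x).1) by move=> a x y; rewrite linearP.
have pL : linear (fun x : subm U => (smval U x).2) by move=> a x y; rewrite linearP.
have iL : linear (fun x => (i x, 0) : (B * V)%type).
  by move=> a x y; rewrite linearP; congr (_, _); rewrite /= scaler0 addr0.
have [i' i'E] := @lift_subm _ _ U (mklin iL)
   (fun x => etrans (exact0 x ip) (esym (linear0 g))).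
exists (subm U), i', (mklin pL), (mklin hL); split=> //.
- split.
  + by move=> x y e; have := i'E x; rewrite e i'E /= => -[/iI].
  + move=> z; split=> [/= z2|[x <-]]; last by rewrite /= i'E.
    have /ipE [x ix] : p (smval U z).1 = 0 by rewrite sv z2 linear0.
    exists x; apply: (@smval_inj _ _ U); rewrite i'E /= ix -z2.
    by rewrite -surjective_pairing.
  + move=> v; have [b pb] := pS (g v).
    have [z zE] := @smval_ex _ _ U (b, v) pb.
    by exists z; rewrite /= zE.
- by move=> x; rewrite /= i'E.
move=> K k kg; have [kI kgE gS] := kg.
have kL : linear (fun x => (0, k x) : (B * V)%type).
  by move=> a x y; rewrite linearP; congr (_, _); rewrite /= scaler0 addr0.
have [k' k'E] := @lift_subm _ _ U (mklin kL)
   (fun x => etrans (linear0 p) (esym (exact0 x kg))).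
exists k'; split; last by move=> x; rewrite /= k'E.
split.
- by move=> x y e; have := k'E x; rewrite e k'E /= => -[/kI].
- move=> z; split=> [/= z1|[x <-]]; last by rewrite /= k'E.
  have /kgE [x kx] : g (smval U z).2 = 0 by rewrite -sv z1 linear0.
  exists x; apply: (@smval_inj _ _ U); rewrite k'E /= kx -z1.
  by rewrite -surjective_pairing.
- move=> b; have [v gv] := gS (p b).
  have [z zE] := @smval_ex _ _ U (b, v) (esym gv).
  by exists z; rewrite /= zE.
Qed.

Lemma projective_basis (T : Type) P (e : T -> P) :
  (forall A (g : T -> A), exists h : {linear P -> A}, forall t, h (e t) = g t) ->
  (forall A (h h' : {linear P -> A}), (forall t, h (e t) = h' (e t)) -> h =1 h') ->
  projective P.
Proof.
move=> eU eE A B p f pS; have [g gP] := choice (fun t => pS (f (e t))).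
have [h hE] := eU _ g; exists h => x.
by apply: (eE _ (p \o h) f) => t /=; rewrite hE.
Qed.

Lemma projective_retract P P' (s : {linear P -> P'}) (r : {linear P' -> P}) :
  cancel s r -> projective P' -> projective P.
Proof.
move=> sK P'P A B p f pS; have [g gE] := P'P _ _ p (f \o r) pS.
by exists (g \o s) => x /=; rewrite gE /= sK.
Qed.

Lemma projective_split A B P (i : {linear A -> B}) (p : {linear B -> P}) :
  projective P -> short_exact i p ->
  exists r : {linear B -> A}, forall x, r (i x) = x.
Proof.
move=> PP [iI ipE pS].
have idL : linear (@idfun P) by [].
have [s sE] := PP _ _ p (mklin idL) pS.
have hL : linear (fun b => b - s (p b)).
  by move=> a x y; rewrite (linearP p) (linearP s) /= scalerBr opprD addrACA.
have [r rE] : exists r : {linear B -> A}, forall x, i (r x) = mklin hL x.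
  by apply: factor_inj => // b; apply/ipE; rewrite /= linearB /= sE subrr.
exists r => x; apply: iI; rewrite rE /=.
have -> : p (i x) = 0 by apply/ipE; exists x.
by rewrite linear0 subr0.
Qed.
End Exact.

(** * Free modules on arbitrary sets and enough projectives *)

Section Free.
Context {R : pzRingType}.

(** The free module on [T]. No finiteness is imposed, as [T] will be the underlying set of an
    arbitrary module. *)
Definition finsupp (T : choiceType) : submodule (T -> R^o).
Proof.
exists (fun f => exists s : seq T, forall x, x \notin s -> f x = 0).
  by exists [::].
move=> a f g [s sP] [t tP]; exists (s ++ t) => x.
rewrite mem_cat negb_or => /andP[xs xt].
by rewrite /= !fctE sP // tP // scaler0 addr0.
Defined.

Section Universal.
Context (T : choiceType) (A : lmodType R) (g : T -> A).

Lemma supp_sum_sub (f : T -> R^o) (s t : seq T) :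
  uniq s -> uniq t -> {subset s <= t} -> (forall x, x \notin s -> f x = 0) ->
  \sum_(x <- t) (f x : R) *: g x = \sum_(x <- s) (f x : R) *: g x.
Proof.
move=> su tu st fs; rewrite [LHS](bigID (mem s)) /=.
rewrite [X in _ + X]big1 ?addr0; last by move=> x xs; rewrite fs // scale0r.
rewrite -big_filter; apply/perm_big/uniq_perm => //; first exact: filter_uniq.
by move=> x; rewrite mem_filter; case xs: (x \in s) => //=; rewrite st.
Qed.

Lemma finsupp_lift (T0 := subm (finsupp T)) :
  exists h : {linear T0 -> A}, forall (u : T0) (s : seq T), uniq s ->
    (forall x, x \notin s -> smval _ u x = 0) -> h u = \sum_(x <- s) (smval _ u x : R) *: g x.
Proof.
pose r (u : T0) y := exists s : seq T, [/\ uniq s,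
    forall x, x \notin s -> smval _ u x = 0 & y = \sum_(x <- s) (smval _ u x : R) *: g x].
have [|||h hP] := @linear_of_rel _ _ _ r.
- move=> u; have [s sP] := smval_in u.
  exists (\sum_(x <- undup s) (smval _ u x : R) *: g x), (undup s).
  by split=> //; [exact: undup_uniq|move=> x; rewrite mem_undup; apply: sP].
- move=> a u y u' y' [s [su sP ->]] [s' [su' sP' ->]].
  have catP x : (x \notin undup (s ++ s')) = (x \notin s) && (x \notin s').
    by rewrite mem_undup mem_cat negb_or.
  exists (undup (s ++ s')); split; first exact: undup_uniq.
    move=> x; rewrite catP => /andP[xs xs'].
    by rewrite linearP !fctE sP // sP' // scaler0 addr0.
  rewrite -(@supp_sum_sub _ s (undup (s ++ s'))) ?undup_uniq //; last first.
    by move=> x xs; rewrite mem_undup mem_cat xs.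
  rewrite -(@supp_sum_sub _ s' (undup (s ++ s'))) ?undup_uniq //; last first.
    by move=> x xs; rewrite mem_undup mem_cat xs orbT.
  rewrite scaler_sumr -big_split; apply: eq_bigr => x _.
  by rewrite linearP !fctE scalerDl scalerA.
- move=> y [s [_ _ ->]]; rewrite big1 // => x _.
  by rewrite linear0 scale0r.
by exists h => u s su sP; apply: hP; exists s.
Qed.
End Universal.

Lemma finsupp_projective (T : choiceType) :
  exists e : T -> subm (finsupp T),
    (forall (A : lmodType R) (g : T -> A),
       exists h : {linear subm (finsupp T) -> A}, forall t, h (e t) = g t) /\
    projective (subm (finsupp T)).
Proof.
have eP t : finsupp T (fun x => (x == t)%:R : R^o).
  by exists [:: t] => x; rewrite inE => /negPf ->.
have [e eE] := choice (fun t => smval_ex (eP t)).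
have eU (A : lmodType R) (g : T -> A) :
    exists h : {linear subm (finsupp T) -> A}, forall t, h (e t) = g t.
  have [h hE] := finsupp_lift g; exists h => t.
  rewrite (hE _ [:: t]) // ?big_seq1 ?eE ?eqxx ?scale1r //.
  by move=> x; rewrite inE => /negPf ->.
exists e; split=> //; apply: (projective_basis eU) => A h h' hh' u.
have [s sP] := smval_in u.
have uE : u = \sum_(x <- undup s) (smval _ u x : R) *: e x.
  apply: smval_inj; rewrite linear_sum /=; apply: funext => y.
  rewrite fct_sumE /=.
  under eq_bigr => x _ do rewrite linearZ /= eE fctE.
  case ys: (y \in s).
    rewrite (bigD1_seq y) ?mem_undup ?undup_uniq //= eqxx big1 ?addr0.
      by rewrite [RHS]mulr1.
    by move=> x /negPf; rewrite eq_sym => ->; rewrite [LHS]mulr0.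
  rewrite sP ?ys // big1_seq // => x /andP[_]; rewrite mem_undup => xs.
  by case: eqP ys => [->|_ _]; rewrite ?xs // [LHS]mulr0.
by rewrite uE !linear_sum; apply: eq_bigr => x _; rewrite !linearZ /= hh'.
Qed.

Lemma enough_projectives (M : lmodType R) :
  exists (P : lmodType R) (p : {linear P -> M}), projective P /\ surjective p.
Proof.
have [e [eU PP]] := finsupp_projective M.
have [p pE] := eU M id; exists (subm (finsupp M)), p; split=> // y.
by exists (e y).
Qed.
End Free.

(** * Vanishing of Ext and projective dimension *)

Section ExtVanishing.
Context {R : pzRingType}.
Implicit Types A B C K M N P U V X Y Z : lmodType R.

Definition Ext1_zero M N := forall A B (i : {linear A -> B}) (p : {linear B -> M}),
  short_exact i p -> forall f : {linear A -> N},
  exists g : {linear B -> N}, forall x, g (i x) = f x.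

(* [Ext_zeroS j M N] says that [Ext^(j+1)(M, N) = 0], in a form that mentions no
   resolution: [Ext^1] through extension of maps, higher degrees by dimension shifting. *)
Fixpoint Ext_zeroS j M N : Prop :=
  if j is j'.+1 then
    forall K P (i : {linear K -> P}) (p : {linear P -> M}),
      projective P -> short_exact i p -> Ext_zeroS j' K N
  else Ext1_zero M N.

Lemma Ext_zeroS_projective j P N : projective P -> Ext_zeroS j P N.
Proof.
elim: j P => [|j IHj] P PP /=.
  move=> A B i p ip f; have [r rE] := projective_split PP ip.
  by exists (f \o r) => x /=; rewrite rE.
move=> K P' i p PP' ip; apply: IHj.
have [r rE] := projective_split PP ip.
exact: projective_retract rE PP'.
Qed.

Lemma Ext1_zero_extension A B C (i : {linear A -> B}) (p : {linear B -> C}) N :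
  short_exact i p -> Ext1_zero A N -> Ext1_zero C N -> Ext1_zero B N.
Proof.
move=> ip EA EC X Y j q jq f.
have [Z [a [b [c [ac bc bE cE]]]]] := ses_preimage jq ip.
have [g gE] := EA _ _ _ _ bc f; have [h hE] := EC _ _ _ _ ac g.
by exists h => x; rewrite -bE hE gE.
Qed.

(* The five-term sequence: [Hom(V, N) -> Hom(U, N) -> Ext^1(A, N) -> Ext^1(V, N)]. *)
Lemma Ext1_zero_quotient U V A (i : {linear U -> V}) (p : {linear V -> A}) N :
  short_exact i p -> Ext1_zero V N ->
  (forall f : {linear U -> N}, exists g : {linear V -> N}, forall x, g (i x) = f x) ->
  Ext1_zero A N.
Proof.
move=> ip EV iN X Y j q jq f.
have [W [j' [q' [h [jq' jE qE]]]]] := ses_pullback p jq.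
move=> /(_ _ _ ip) [k [kh kE]].
have [g gE] := EV _ _ _ _ jq' f; have [u uE] := iN (g \o k).
have gL : linear (fun w => g w - u (q' w)).
  by move=> a x y; rewrite (linearP g) (linearP q') (linearP u) /= scalerBr opprD addrACA.
have [_ khE hS] := kh.
have [g' g'E] : exists g' : {linear Y -> N}, forall w, g' (h w) = mklin gL w.
  apply: factor_surj => // w /khE [x <-] /=.
  by rewrite kE uE subrr.
exists g' => x; rewrite -jE g'E /= gE.
by rewrite (exact0 _ jq') linear0 subr0.
Qed.

(** Fragments of the long exact sequence, interleaved by the induction: at [j.+1] the first two use
    the third and each other at [j], and the third follows from them by comparing two covers of [M]
    through their fibre product. *)
Lemma Ext_zeroS_sequences N j :
  [/\ forall A B C (i : {linear A -> B}) (p : {linear B -> C}), short_exact i p ->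
        Ext_zeroS j A N -> Ext_zeroS j C N -> Ext_zeroS j B N,
      forall A B C (i : {linear A -> B}) (p : {linear B -> C}), short_exact i p ->
        Ext_zeroS j B N -> Ext_zeroS j.+1 C N -> Ext_zeroS j A N &
      forall K P M (i : {linear K -> P}) (p : {linear P -> M}), projective P ->
        short_exact i p -> Ext_zeroS j K N -> Ext_zeroS j.+1 M N].
Proof.
elim: j => [|j [ext ker syz]].
  have ker0 A B C (i : {linear A -> B}) (p : {linear B -> C}) : short_exact i p ->
      Ext_zeroS 0 B N -> Ext_zeroS 1 C N -> Ext_zeroS 0 A N.
    move=> ip EB EC; have [P [q [PP qS]]] := enough_projectives B.
    have qE := short_exact_ker qS.
    have [Z [a [b [c [ac bc bE cE]]]]] := ses_preimage qE ip.
    apply: (Ext1_zero_quotient bc); first exact: EC PP ac.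
    move=> f; have [g gE] := EB _ _ _ _ qE f.
    by exists (g \o a) => x /=; rewrite bE gE.
  split=> //; first by move=> A B C i p; apply: Ext1_zero_extension.
  move=> K P M i p PP ip EK K' P' i' p' PP' ip'.
  have [X [k [q [h [kq _ _ /(_ _ _ ip') [k' [kh _]]]]]]] := ses_pullback p' ip.
  apply: (ker0 _ _ _ _ _ kh); last exact: Ext_zeroS_projective.
  exact: (Ext1_zero_extension kq) (Ext_zeroS_projective 0 _ PP').
have extS A B C (i : {linear A -> B}) (p : {linear B -> C}) : short_exact i p ->
    Ext_zeroS j.+1 A N -> Ext_zeroS j.+1 C N -> Ext_zeroS j.+1 B N.
  move=> ip EA EC; have [P [q [PP qS]]] := enough_projectives B.
  have qE := short_exact_ker qS.
  have [Z [a [b [c [ac bc _ _]]]]] := ses_preimage qE ip.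
  exact: syz PP qE (ker _ _ _ _ _ bc (EC _ _ _ _ PP ac) EA).
have kerS A B C (i : {linear A -> B}) (p : {linear B -> C}) : short_exact i p ->
    Ext_zeroS j.+1 B N -> Ext_zeroS j.+2 C N -> Ext_zeroS j.+1 A N.
  move=> ip EB EC; have [P [q [PP qS]]] := enough_projectives B.
  have qE := short_exact_ker qS.
  have [Z [a [b [c [ac bc _ _]]]]] := ses_preimage qE ip.
  have EZ : Ext_zeroS j.+1 Z N := EC _ _ _ _ PP ac.
  have EK : Ext_zeroS j (subm (kerm q)) N := EB _ _ _ _ PP qE.
  (* [Z] need not be projective, so [A] is covered by a projective [P'] through [Z]; the kernel [Z']
     is an extension of [subm (kerm q)] by the kernel of [q']. *)
  have [P' [q' [PP' q'S]]] := enough_projectives Z.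
  have qE' := short_exact_ker q'S.
  have [Z' [a' [b' [c' [ac' bc' _ _]]]]] := ses_preimage qE' bc.
  apply: (syz _ _ _ _ _ PP' ac').
  exact: ext bc' (EZ _ _ _ _ PP' qE') EK.
split=> // K P M i p PP ip EK K' P' i' p' PP' ip'.
have [X [k [q [h [kq _ _ /(_ _ _ ip') [k' [kh _]]]]]]] := ses_pullback p' ip.
apply: (kerS _ _ _ _ _ kh); last exact: Ext_zeroS_projective.
exact: extS kq EK (Ext_zeroS_projective _ _ PP').
Qed.

Section LongExactSequence.
Context {A B C N : lmodType R} {i : {linear A -> B}} {p : {linear B -> C}}.
Context (ip : short_exact i p).

Lemma Ext_zeroS_mid j : Ext_zeroS j A N -> Ext_zeroS j C N -> Ext_zeroS j B N.
Proof. by have [h _ _] := Ext_zeroS_sequences N j; apply: h ip. Qed.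

Lemma Ext_zeroS_left j : Ext_zeroS j B N -> Ext_zeroS j.+1 C N -> Ext_zeroS j A N.
Proof. by have [_ h _] := Ext_zeroS_sequences N j; apply: h ip. Qed.

Lemma Ext_zeroS_syzygy j : projective B -> Ext_zeroS j A N -> Ext_zeroS j.+1 C N.
Proof. by have [_ _ h] := Ext_zeroS_sequences N j; move=> PB; apply: h ip. Qed.

Lemma Ext_zeroS_right j : Ext_zeroS j A N -> Ext_zeroS j.+1 B N -> Ext_zeroS j.+1 C N.
Proof.
have [ext _ _] := Ext_zeroS_sequences N j; have [_ _ syz] := Ext_zeroS_sequences N j.
move=> EA EB; have [P [q [PP qS]]] := enough_projectives B.
have qE := short_exact_ker qS.
have [Z [a [b [c [ac bc _ _]]]]] := ses_preimage qE ip.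
apply: (syz _ _ _ _ _ PP ac).
exact: ext bc (EB _ _ _ _ PP qE) EA.
Qed.
End LongExactSequence.

(** * Comparison with projective resolutions *)

Definition splice_obj K P (Q : proj_resolution K) (n : nat) :=
  if n is n'.+1 then res_obj Q n' else P.

Definition splice_d K P (i : {linear K -> P}) (Q : proj_resolution K) (n : nat) :
    {linear splice_obj P Q n.+1 -> splice_obj P Q n} :=
  match n with
  | 0%N => mklin (linearP (i \o res_aug Q))
  | n'.+1 => res_d Q n'
  end.

Definition splice K P M (i : {linear K -> P}) (p : {linear P -> M}) (PP : projective P)
  (ip : short_exact i p) (Q : proj_resolution K) : proj_resolution M.
Proof.
exists (splice_obj P Q) (splice_d i Q) p.
- by case=> [|n] //=; apply: res_proj.
- by case: ip.
- have [_ ipE _] := ip.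
  move=> y; rewrite ipE; split=> [[x <-]|[x <-]]; last by exists (res_aug Q x).
  by have [z <-] := res_aug_surj Q x; exists z.
- have [iI _ _] := ip; case=> [|n] y /=; last exact: res_exact.
  rewrite -res_exact0; split=> [|->]; last exact: linear0.
  exact: (inj_eq0 iI).
Defined.

Lemma truncate_map M (Q : proj_resolution M) :
  exists a : {linear res_obj Q 1 -> subm (kerm (res_aug Q))},
    forall x, smval _ (a x) = res_d Q 0 x.
Proof. by apply: lift_subm => x; apply/res_exact0; exists x. Qed.

Definition truncate M (Q : proj_resolution M)
  (a : {linear res_obj Q 1 -> subm (kerm (res_aug Q))})
  (aE : forall x, smval _ (a x) = res_d Q 0 x) : proj_resolution (subm (kerm (res_aug Q))).
Proof.
exists (fun n => res_obj Q n.+1) (fun n => res_d Q n.+1) a.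
- by move=> n; apply: res_proj.
- move=> y; have /res_exact0 [x xy] := smval_in y.
  by exists x; apply: smval_inj; rewrite aE.
- move=> y; rewrite -res_exact -aE; split=> [->|ay]; first exact: linear0.
  by apply: smval_inj; rewrite ay linear0.
- by move=> n; apply: res_exact.
Defined.

Lemma proj_resolution_exists M : exists Q : proj_resolution M, True.
Proof.
pose cov (L : lmodType R) := projT1 (cid (enough_projectives L)).
pose q (L : lmodType R) : {linear cov L -> L} :=
  projT1 (cid (projT2 (cid (enough_projectives L)))).
have covP (L : lmodType R) : projective (cov L) /\ surjective (q L).
  exact: (projT2 (cid (projT2 (cid (enough_projectives L))))).
pose syz := fix syz n := if n is n'.+1 then subm (kerm (q (syz n'))) else M.
have qS n : surjective (q (syz n)) by case: (covP (syz n)).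
pose d n : {linear cov (syz n.+1) -> cov (syz n)} :=
  mklin (linearP (smval (kerm (q (syz n))) \o q (syz n.+1))).
have dE n y : q (syz n) y = 0 <-> exists x, d n x = y.
  split=> [/(@smval_ex _ _ (kerm (q (syz n)))) [z <-]|[x <-]].
    by have [x <-] := qS n.+1 z; exists x.
  exact: (smval_in (q (syz n.+1) x)).
unshelve eexists (@ProjResolution R M (fun n => cov (syz n)) d (q M) _ _ _ _) => //.
- by move=> n; case: (covP (syz n)).
- exact: (qS 0).
- exact: (dE 0).
- move=> n y; rewrite -dE /=; split=> [/(inj_eq0 (@smval_inj _ _ _))|->] //.
  exact: linear0.
Qed.

(** Splicing a cover onto a resolution of its kernel, and truncating a resolution, translate one
    notion into the other: [f] on the kernel becomes the 1-cocycle [f \o res_aug Q], and extending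
    [f] means writing this as a coboundary. *)
Lemma Ext_zero_S j M N : Ext_zero j.+1 M N <-> Ext_zeroS j M N.
Proof.
split; elim: j M => [|j IHj] M.
- move=> EM; have [P [p [PP pS]]] := enough_projectives M.
  have ip := short_exact_ker pS.
  have [Q _] := proj_resolution_exists (subm (kerm p)).
  apply: (Ext1_zero_quotient ip); first exact: (Ext_zeroS_projective 0).
  move=> f; have [|g gE] := EM (splice PP ip Q) (mklin (linearP (f \o res_aug Q))).
    move=> x /=; suff -> : res_aug Q (res_d Q 0 x) = 0 by rewrite linear0.
    by apply/res_exact0; exists x.
  exists g => x; have [y <-] := res_aug_surj Q x.
  exact: (esym (gE y)).
- move=> EM K P i p PP ip; apply: IHj => Q f fc.
  exact: (EM (splice PP ip Q) f fc).
- move=> EM Q f fc; pose q := res_aug Q; have [a aE] := truncate_map Q.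
  have [g gE] : exists g : {linear subm (kerm q) -> N}, forall x, g (a x) = f x.
    apply: factor_surj; first exact: (res_aug_surj (truncate aE)).
    by move=> x /(@res_exact0 _ _ (truncate aE) x) [y <-]; apply: fc.
  have [h hE] := EM _ _ _ _ (short_exact_ker (res_aug_surj Q)) g.
  by exists h => x; rewrite -aE hE gE.
- move=> EM Q f fc; have [a aE] := truncate_map Q.
  have EK := EM _ _ _ _ (@res_proj _ _ Q 0) (short_exact_ker (res_aug_surj Q)).
  exact: (IHj _ EK (truncate aE) f fc).
Qed.

(** Extending the identity of the kernel to the whole cover splits the cover. *)
Lemma projective_Ext1 M : (forall N, Ext1_zero M N) -> projective M.
Proof.
move=> EM; have [P [p [PP pS]]] := enough_projectives M.
have ip := short_exact_ker pS.
have [r rE] := EM _ _ _ _ _ ip (mklin (linearP (@idfun (subm (kerm p))))).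
have sL : linear (fun x => x - smval _ (r x)).
  by move=> a x y; rewrite (linearP r) (linearP (smval _)) /= scalerBr opprD addrACA.
have [s sE] : exists s : {linear M -> P}, forall x, s (p x) = mklin sL x.
  apply: factor_surj => // x /(@smval_ex _ _ (kerm p)) [z <-] /=.
  by rewrite rE subrr.
apply: (@projective_retract _ _ _ s p) => // m.
have [x <-] := pS m; rewrite sE /= linearB /=.
have rx : p (smval _ (r x)) = 0 := smval_in (r x).
by rewrite rx subr0.
Qed.

Lemma pd_leP M k : pd_le M k <-> forall N, Ext_zeroS k M N.
Proof.
split; elim: k M => [|k IHk] M.
- move=> [Q Q0] N; apply: Ext_zeroS_projective.
  (* The terms above degree 0 vanish, so the augmentation is an isomorphism. *)
  have qI : injective (res_aug Q).
    apply: linear_inj => y /res_exact0 [x <-].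
    by rewrite (Q0 1%N isT x) linear0.
  have [s sE] : exists s : {linear M -> res_obj Q 0},
      forall x, res_aug Q (s x) = mklin (linearP (@idfun M)) x.
    by apply: factor_inj => // x; apply: res_aug_surj.
  exact: projective_retract sE (@res_proj _ _ Q 0).
- move=> [Q Q0] N; have [a aE] := truncate_map Q.
  apply: (Ext_zeroS_syzygy (short_exact_ker (res_aug_surj Q)) (@res_proj _ _ Q 0)).
  by apply: IHk; exists (truncate aE) => i ki; apply: Q0.
- move=> /projective_Ext1 PM.
  pose idM := mklin (linearP (@idfun M)).
  (* The zero module with its zero resolution, spliced onto the cover [idM], yields a resolution of
     length 0. *)
  pose Z := subm (kerm idM).
  have Z0 (z : Z) : z = 0.
    by apply: smval_inj; rewrite linear0; apply: (smval_in z).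
  have PZ : projective Z.
    move=> A B p f pS; exists (mklin (linearP (\0 : Z -> A))) => x.
    by rewrite (Z0 x) !linear0.
  pose zz := mklin (linearP (\0 : Z -> Z)).
  have zzE : exact_at zz zz by move=> y; split=> _; [exists 0|]; rewrite (Z0 y) ?linear0.
  have zzS : surjective zz by move=> y; exists 0; rewrite (Z0 y) linear0.
  pose Q := @ProjResolution R Z (fun=> Z) (fun=> zz) zz (fun=> PZ) zzS zzE (fun=> zzE).
  have ip : short_exact (smval (kerm idM)) idM.
    by apply: short_exact_ker => y; exists y.
  by exists (splice PM ip Q); case.
- move=> EM; have [P [p [PP pS]]] := enough_projectives M.
  have ip := short_exact_ker pS.
  have [Q Q0] : pd_le (subm (kerm p)) k by apply: IHk => N; apply: EM PP ip.
  by exists (splice PP ip Q); case=> // i ki x; apply: (Q0 i).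
Qed.

Lemma pd_le_trans M k l : (k <= l)%N -> pd_le M k -> pd_le M l.
Proof. by move=> kl [Q Q0]; exists Q => i li; apply: Q0 (leq_ltn_trans kl li). Qed.

Lemma Ext_zeroS_pd M N k j : (k <= j)%N -> pd_le M k -> Ext_zeroS j M N.
Proof. by move=> kj /(pd_le_trans kj) /pd_leP; apply. Qed.
End ExtVanishing.

(** * Finitely generated modules *)

Section Span.
Context {R : pzRingType}.
Implicit Types M N : lmodType R.

(** A recursion on the generators suits induction on [s]; [in_spanP] recovers the usual sums. *)
Fixpoint in_span M (s : seq M) (x : M) : Prop :=
  if s is v :: s' then exists a : R, in_span s' (x - a *: v) else x = 0.

Lemma in_spanP M (s : seq M) x : in_span s x <->
  exists c : nat -> R, x = \sum_(i < size s) c i *: s`_i.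
Proof.
elim: s x => [|v s IHs] x /=.
  by split=> [->|[c ->]]; [exists (fun=> 0)|]; rewrite big_ord0.
split=> [[a /IHs [c cE]]|[c ->]].
  exists (fun n => if n is n'.+1 then c n' else a).
  by rewrite big_ord_recl /= -cE addrC subrK.
exists (c 0%N); apply/IHs; exists (fun n => c n.+1).
by rewrite big_ord_recl /= addrC addKr.
Qed.

Lemma in_span_lin M (s : seq M) a x y :
  in_span s x -> in_span s y -> in_span s (a *: x + y).
Proof.
elim: s x y => [|v s IHs] x y /=; first by move=> -> ->; rewrite scaler0 addr0.
move=> [b xb] [c yc]; exists (a * b + c).
by rewrite scalerDl -scalerA opprD addrACA -scalerBr; apply: IHs.
Qed.

Lemma in_span0 M (s : seq M) : in_span s 0.
Proof. by elim: s => //= v s IHs; exists 0; rewrite scale0r subr0. Qed.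

Definition span_mod M (s : seq M) : submodule M := Submodule (in_span0 s) (@in_span_lin M s).

Lemma in_span_cat M (s t : seq M) x y : in_span s x -> in_span t y -> in_span (s ++ t) (x + y).
Proof.
elim: s x => [|v s IHs] x /=; first by move=> ->; rewrite add0r.
by move=> [a xa] yt; exists a; rewrite addrAC; apply: IHs.
Qed.

Lemma in_span_sum M I (r : seq I) (c : I -> R) (v : I -> M) :
  in_span [seq v i | i <- r] (\sum_(i <- r) c i *: v i).
Proof.
elim: r => [|i r IHr] /=; first by rewrite big_nil.
by exists (c i); rewrite big_cons addrC addKr.
Qed.

Lemma in_span_map M N (f : {linear M -> N}) s x : in_span s x -> in_span (map f s) (f x).
Proof.
elim: s x => [|v s IHs] x /=; first by move->; rewrite linear0.
by move=> [a /IHs xa]; exists a; rewrite linearB linearZ in xa.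
Qed.

Lemma in_span_map_inj M N (f : {linear M -> N}) s x :
  injective f -> in_span (map f s) (f x) -> in_span s x.
Proof.
move=> fI; elim: s x => [|v s IHs] x /=; first exact: inj_eq0.
by move=> [a xa]; exists a; apply: IHs; rewrite linearB linearZ.
Qed.

Lemma fgP M : finitely_generated M <-> exists s : seq M, forall x, in_span s x.
Proof.
split=> [[n [v vP]]|[s sP]].
  exists [seq v i | i <- enum 'I_n] => x; have [c ->] := vP x.
  by rewrite -big_enum; apply: in_span_sum.
exists (size s), (fun i => s`_i) => x; have /in_spanP [c ->] := sP x.
by exists (fun i => c i).
Qed.

Lemma fg_surj M N (f : {linear M -> N}) :
  surjective f -> finitely_generated M -> finitely_generated N.
Proof.
move=> fS /fgP [s sP]; apply/fgP; exists (map f s) => y.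
by have [x <-] := fS y; apply: in_span_map.
Qed.

Section Noetherian.
Context (hl : left_noetherian R).

(** The coefficients at [v] of elements of [U] form a left ideal. Elements of [U] that realise its
    finitely many generators reduce every other element of [U] to the span of [s], where the
    induction applies. *)
Lemma noetherian_span M (s : seq M) (U : submodule M) :
  (forall x, U x -> in_span s x) ->
  exists t : seq M, (forall x, x \in t -> U x) /\ forall x, U x -> in_span t x.
Proof.
elim: s U => [|v s IHs] U Us; first by exists [::].
pose I r := exists u, U u /\ in_span s (u - r *: v).
have I_ideal : left_ideal I.
  split.
  - by exists 0; rewrite scale0r subr0; split; [apply: sm_zero|apply: in_span0].
  - move=> a b [x [Ux xa]] [y [Uy yb]]; exists (x + y); split; first exact: smD.
    by rewrite scalerDl opprD addrACA; apply: (smD (U := span_mod s)).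
  - move=> a b [x [Ux xa]]; exists (a *: x); split; first exact: smZ.
    by rewrite -scalerA -scalerBr; apply: (smZ (U := span_mod s)).
have [n [r rP]] := hl I_ideal.
have /choice [u uP] : forall i, exists u, U u /\ in_span s (u - r i *: v).
  move=> i; apply/rP; exists (fun j => (j == i)%:R).
  rewrite (bigD1 i) //= eqxx mul1r big1 ?addr0 // => j /negPf ->.
  by rewrite mul0r.
have W0 : U 0 /\ in_span s (0 : M) by split; [apply: sm_zero|apply: in_span0].
have WL a x y : U x /\ in_span s x -> U y /\ in_span s y ->
    U (a *: x + y) /\ in_span s (a *: x + y).
  by move=> [Ux sx] [Uy sy]; split; [apply: sm_lin|apply: in_span_lin].
have [t [tU tP]] := IHs (Submodule W0 WL) (fun x => @proj2 _ _).
exists ([seq u i | i <- enum 'I_n] ++ t); split=> [x|x Ux].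
  rewrite mem_cat => /orP[/mapP[i _ ->]|/tU []//].
  by case: (uP i).
have /= [a sa] := Us x Ux.
have /rP [c aE] : I a by exists x.
rewrite -[x](subrK (\sum_i c i *: u i)) addrC; apply: in_span_cat.
  by rewrite -big_enum; apply: in_span_sum.
apply: tP; split.
  by apply: smB => //; apply: sm_sum => i; apply: smZ; case: (uP i).
have -> : x - \sum_i c i *: u i = (x - a *: v) - \sum_i c i *: (u i - r i *: v).
  under [X in _ = _ - X]eq_bigr => i _ do rewrite scalerBr scalerA.
  by rewrite sumrB -scaler_suml -aE opprB addrA subrK.
apply: (smB (U := span_mod s)) => //.
by apply: (sm_sum (U := span_mod s)) => i; apply: (smZ (U := span_mod s)); case: (uP i).
Qed.

Lemma fg_submodule M (U : submodule M) : finitely_generated M -> finitely_generated (subm U).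
Proof.
move=> /fgP [s sP]; have [t [tU tP]] := @noetherian_span M s U (fun x _ => sP x).
apply/fgP.
have [t' t'E] : exists t' : seq (subm U), map (smval U) t' = t.
  elim: t tU {tP} => [|v t IHt] tU; first by exists [::].
  have [|t' t'E] := IHt; first by move=> x xt; apply: tU; rewrite inE xt orbT.
  have [v' v'E] := smval_ex (tU v (mem_head v t)).
  by exists (v' :: t'); rewrite /= v'E t'E.
exists t' => x; apply: in_span_map_inj (@smval_inj _ _ U) _.
by rewrite t'E; apply: tP; apply: smval_in.
Qed.

Lemma fg_inj M N (f : {linear M -> N}) :
  injective f -> finitely_generated N -> finitely_generated M.
Proof.
move=> fI Nfg; have [|g gE] := @lift_subm _ _ _ (imm f) f; first by move=> x; exists x.
have gS : surjective g.
  move=> y; have [x xy] := smval_in y; exists x; apply: smval_inj.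
  by rewrite gE.
have gI : injective g by move=> x y gxy; apply: fI; rewrite -!gE gxy.
have [h hE] : exists h : {linear subm (imm f) -> M},
    forall x, g (h x) = mklin (linearP (@idfun (subm (imm f)))) x.
  by apply: factor_inj.
apply: (@fg_surj _ _ h); last exact: fg_submodule.
by move=> x; exists (g x); apply: gI; rewrite hE.
Qed.
End Noetherian.

Definition freem n : lmodType R := GRing.Lmodule.clone R ('I_n -> R^o) _.

Definition fbasis n (i : 'I_n) : freem n := fun j => (j == i)%:R.

Lemma fbasis_sum n (x : freem n) : x = \sum_(i < n) (x i : R) *: fbasis i.
Proof.
apply: funext => j; rewrite fct_sumE (bigD1 j) //= fctE /fbasis eqxx.
rewrite big1 => [|i /negPf ij]; first by rewrite addr0 [RHS]mulr1.
by rewrite fctE eq_sym ij [LHS]mulr0.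
Qed.

Lemma fsum_linear n M (g : 'I_n -> M) :
  linear (fun x : freem n => \sum_(i < n) (x i : R) *: g i).
Proof.
move=> a x y; rewrite scaler_sumr -big_split; apply: eq_bigr => i _.
by rewrite fctE scalerDl scalerA.
Qed.

Definition fsum n M (g : 'I_n -> M) : {linear freem n -> M} := mklin (fsum_linear g).

Lemma fsum_basis n M (g : 'I_n -> M) i : fsum g (fbasis i) = g i.
Proof.
rewrite /= (bigD1 i) //= /fbasis eqxx scale1r big1 ?addr0 // => j /negPf ->.
by rewrite scale0r.
Qed.

Lemma freem_ext n M (f f' : {linear freem n -> M}) :
  (forall i, f (fbasis i) = f' (fbasis i)) -> f =1 f'.
Proof.
move=> ff' x; rewrite (fbasis_sum x) !linear_sum; apply: eq_bigr => i _.
by rewrite !linearZ /= ff'.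
Qed.

Lemma freem_projective n : projective (freem n).
Proof.
apply: (@projective_basis _ 'I_n _ (@fbasis n)) => [A g|A h h'].
  by exists (fsum g) => i; apply: fsum_basis.
exact: freem_ext.
Qed.

Lemma freem_fg n : finitely_generated (freem n).
Proof. by exists n, (@fbasis n) => x; exists x; apply: fbasis_sum. Qed.

Lemma fg_freem M : finitely_generated M -> exists n (p : {linear freem n -> M}), surjective p.
Proof.
move=> [n [v vP]]; exists n, (fsum v) => x.
by have [c ->] := vP x; exists c.
Qed.
End Span.

(** * Projective dimension read off from Ext into the ring *)

Section ProjectiveDimension.
Context {R : pzRingType}.
Context (hl : left_noetherian R).
Implicit Types M : lmodType R.

(* As [Ext^k(M, R) = 0], the k-th syzygy, a summand of some [R^m], splits off. *)
Lemma pd_le_drop M k : finitely_generated M -> pd_le M k.+1 ->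
  Ext_zeroS k M R^o -> pd_le M k.
Proof.
move=> Mfg /pd_leP pdM EM; apply/pd_leP.
elim: k M Mfg pdM EM => [|k IHk] M Mfg pdM EM N;
    have [n [p pS]] := fg_freem Mfg; have ip := short_exact_ker pS;
    have PF := @freem_projective R n;
    have Kfg := @fg_submodule R hl _ (kerm p) (freem_fg n).
  have PK : projective (subm (kerm p)).
    by apply: projective_Ext1 => N'; apply: (pdM N' _ _ _ _ PF ip).
  have [m [q qS]] := fg_freem Kfg.
  have [s sE] := PK _ _ q (mklin (linearP idfun)) qS.
  (* The coordinates of the section [s] extend from the kernel to [freem n] because Ext^1(M, R) = 0;
     followed by [q], the extension retracts [freem n] onto the kernel. *)
  have /choice [t tE] : forall j : 'I_m, exists t : {linear freem n -> R^o},
      forall x, t (smval _ x) = (s x j : R^o).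
    move=> j; have sL : linear (fun x => s x j : R^o) by move=> a x y; rewrite linearP.
    exact: (EM _ _ _ _ ip (mklin sL)).
  have tL : linear (fun x j => t j x : R^o).
    by move=> a x y; apply: funext => j; rewrite linearP.
  have hL : linear (fun x => x - smval _ (q (fun j => t j x : R^o))).
    move=> a x y; rewrite tL.
    by rewrite (linearP q) (linearP (smval _)) /= scalerBr opprD addrACA.
  have [h hE] : exists h : {linear M -> freem n}, forall x, h (p x) = mklin hL x.
    apply: factor_surj => // x /(@smval_ex _ _ (kerm p)) [z <-] /=.
    rewrite (_ : (fun j => _) = s z); last by apply: funext => j; rewrite tE.
    by rewrite sE subrr.
  apply: Ext_zeroS_projective; apply: (@projective_retract _ _ _ h p) PF => y.
  have [x <-] := pS y; rewrite hE /= linearB /=.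
  have pq : p (smval _ (q (fun j => t j x : R^o))) = 0 := smval_in (q _).
  by rewrite pq subr0.
apply: (Ext_zeroS_syzygy ip PF); apply: IHk => //; last exact: EM PF ip.
by move=> N'; apply: (pdM N' _ _ _ _ PF ip).
Qed.

(** Any finite bound is lowered one step at a time. For [k = 1] this puts the modules of finite pd
    with pd* <= 1 among those with pd <= 1. *)
Lemma pd_le_of_Ext M k : finitely_generated M -> pd_finite M ->
  (forall j, (k <= j)%N -> Ext_zeroS j M R^o) -> pd_le M k.
Proof.
move=> Mfg [l pdM] EM; have [/pd_le_trans/(_ pdM)//|/ltnW kl] := leqP l k.
rewrite -(subnKC kl) in pdM; elim: (l - k)%N pdM => [|e IHe]; first by rewrite addn0.
rewrite addnS => pdM; apply: IHe; apply: pd_le_drop => //.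
by apply: EM; apply: leq_addr.
Qed.
End ProjectiveDimension.

(** * Ore sets and covers of torsion modules *)

Section Ore.
Context {R : pzRingType} (S : R -> Prop) (hS : ore_set S).
Implicit Types M N : lmodType R.

(** A common left denominator for the finitely many fractions a_i s_i^-1, built by repeated use of
    the left Ore condition. *)
Lemma common_left_multiple (I : eqType) (r : seq I) (a s : I -> R) : (forall i, S (s i)) ->
  exists t, S t /\ forall i, i \in r -> exists d, t * a i = d * s i.
Proof.
move=> sS; elim: r => [|i r [t [tS tP]]]; first by exists 1; split=> //; apply: ore_one hS.
have [d [u [uS du]]] := ore_left hS (t * a i) (sS i).
exists (u * t); split=> [|j]; first exact: (ore_mul hS).
rewrite inE => /predU1P[->|/tP [d' dE]]; first by exists d; rewrite du mulrA.
by exists (u * d'); rewrite -!mulrA dE.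
Qed.

Lemma torsion_surj M N (f : {linear M -> N}) : surjective f -> torsion S M -> torsion S N.
Proof.
move=> fS tM y; have [x <-] := fS y; have [s [sS sx]] := tM x.
by exists s; rewrite -linearZ sx linear0.
Qed.

Lemma torsion_inj M N (f : {linear M -> N}) : injective f -> torsion S N -> torsion S M.
Proof.
move=> fI tN x; have [s [sS sx]] := tN (f x).
by exists s; split=> //; apply: (inj_eq0 fI); rewrite linearZ.
Qed.

Section Cyclic.
Context {n : nat} (s : 'I_n -> R).

Lemma diag_linear : linear (fun d : freem n => (fun i => (d i : R) * s i : R^o) : freem n).
Proof. by move=> a x y; apply: funext => i; rewrite !fctE mulrDl -mulrA. Qed.

(** Multiplication by the [s i] from the right, hence left linear; its cokernel is the direct sum of
    the R / R s_i. *)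
Definition diag : {linear freem n -> freem n} := mklin diag_linear.

Definition cyclics : lmodType R := quom (imm diag).

Lemma cyclics_fg : finitely_generated cyclics.
Proof. exact: fg_surj (@qpi_surj _ _ _) (freem_fg n). Qed.

Context (sS : forall i, S (s i)).

Lemma cyclics_torsion : torsion S cyclics.
Proof.
move=> x; have [c <-] := qpi_surj x.
have [t [tS tP]] := common_left_multiple (enum 'I_n) (c : 'I_n -> R) sS.
exists t; split=> //; rewrite -linearZ; apply/qpi_eq0.
have /choice [d dE] : forall i, exists d, t * (c i : R) = d * s i.
  by move=> i; apply: tP; rewrite mem_enum.
by exists d; apply: funext => i; rewrite /= -dE.
Qed.

Context (hreg : forall f : R, S f -> non_zero_divisor f).

Lemma cyclics_exact : short_exact diag (qpi (imm diag)).
Proof.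
apply: short_exact_coker => x y xy; apply: funext => i.
have [_ sr] := hreg (sS i); apply: sr.
exact: (congr1 (fun f => f i) xy).
Qed.

Lemma cyclics_pd : pd_le cyclics 1.
Proof.
apply/pd_leP => N; apply: (Ext_zeroS_syzygy cyclics_exact); first exact: freem_projective.
exact/(Ext_zeroS_projective 0)/freem_projective.
Qed.
End Cyclic.

Lemma torsion_cover M : (forall f : R, S f -> non_zero_divisor f) ->
  finitely_generated M -> torsion S M ->
  exists (P : lmodType R) (p : {linear P -> M}),
    [/\ finitely_generated P, torsion S P, pd_le P 1 & surjective p].
Proof.
move=> hreg [n [v vP]] tM; have /choice [s sP] := fun i => tM (v i).
have sS i : S (s i) by case: (sP i).
have [p pE] : exists p : {linear cyclics s -> M}, forall x, p (qpi _ x) = fsum v x.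
  apply: factor_surj; first exact: qpi_surj.
  move=> x /qpi_eq0 [d <-] /=; apply: big1 => i _.
  by rewrite -scalerA; case: (sP i) => _ ->; rewrite scaler0.
exists (cyclics s), p; split.
- exact: cyclics_fg.
- exact: cyclics_torsion.
- exact: cyclics_pd.
- by move=> x; have [c ->] := vP x; exists (qpi (imm (diag s)) (c : freem n)); rewrite pE.
Qed.
End Ore.

(** * Duality *)

Section Dual.
Context {R : pzRingType}.
Implicit Types K L M : lmodType R.

Definition dual_fun K : lmodType R^c := GRing.Lmodule.clone R^c (K -> (R^c)^o) _.

(* [Hom_R(K, R)] as a right module: in [(R^c)^o], [r *: y] is the product [y * r] of [R]. *)
Definition dual_mod K : submodule (dual_fun K).
Proof.
exists (fun phi : K -> (R^c)^o =>
  forall a x y, phi (a *: x + y) = a * (phi x : R) + (phi y : R) :> R).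
  by move=> a x y; change (0 = a * 0 + 0 :> R); rewrite mulr0 addr0.
move=> r phi psi phiL psiL a x y.
change ((phi (a *: x + y) : R) * (r : R) + (psi (a *: x + y) : R) =
        a * ((phi x : R) * (r : R) + (psi x : R)) + ((phi y : R) * (r : R) + (psi y : R)) :> R).
rewrite phiL psiL.
by rewrite !mulrDl mulrDr -mulrA addrACA.
Defined.

Definition dual K : lmodType R^c := subm (dual_mod K).

Definition dev K (phi : dual K) (x : K) : R := smval (dual_mod K) phi x.

Lemma dev_linear K (phi : dual K) : linear (dev phi : K -> R^o).
Proof. exact: (smval_in phi). Qed.

Definition dlin K (phi : dual K) : {linear K -> R^o} := mklin (dev_linear phi).

Lemma devr0 K (phi : dual K) : dev phi 0 = 0.
Proof. exact: (linear0 (dlin phi)). Qed.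

Lemma devrZ K (phi : dual K) a x : dev phi (a *: x) = a * dev phi x.
Proof. by rewrite -[LHS]/(dlin phi _) linearZ. Qed.

Lemma devr_sum K (phi : dual K) I (r : seq I) (c : I -> R) (v : I -> K) :
  dev phi (\sum_(i <- r) c i *: v i) = \sum_(i <- r) c i * dev phi (v i).
Proof.
rewrite -[LHS]/(dlin phi _) linear_sum; apply: eq_bigr => i _.
exact: devrZ.
Qed.

Lemma dual_ex K (f : {linear K -> R^o}) : exists phi : dual K, forall x, dev phi x = f x.
Proof.
have fD : dual_mod K (f : dual_fun K) by move=> a x y; apply: (linearP f).
by have [phi phiE] := smval_ex fD; exists phi => x; rewrite /dev phiE.
Qed.

Lemma dual_eq K (phi psi : dual K) : dev phi =1 dev psi -> phi = psi.
Proof. by move=> e; apply: smval_inj; apply: funext. Qed.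

Lemma dev_lin K (r : R) (phi psi : dual K) x :
  dev ((r : R^c) *: phi + psi) x = dev phi x * r + dev psi x.
Proof. by rewrite /dev linearP. Qed.

Lemma dev0 K x : dev (0 : dual K) x = 0.
Proof. by rewrite /dev linear0. Qed.

Lemma dev_sum K I (s : seq I) (c : I -> R^c) (phi : I -> dual K) x :
  dev (\sum_(i <- s) c i *: phi i) x = \sum_(i <- s) dev (phi i) x * (c i : R).
Proof.
elim: s => [|i s IHs]; first by rewrite !big_nil dev0.
by rewrite !big_cons dev_lin IHs.
Qed.

Lemma dual_map K L (f : {linear K -> L}) :
  exists f' : {linear dual L -> dual K}, forall phi x, dev (f' phi) x = dev phi (f x).
Proof.
have [f' f'E] := choice (fun phi => dual_ex (mklin (linearP (dlin phi \o f)))).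
have f'L : linear f'.
  by move=> a phi psi; apply: dual_eq => x; rewrite dev_lin !f'E /= dev_lin.
by exists (mklin f'L) => phi x; rewrite /= f'E.
Qed.

(** Ext^1(M, R) = 0 lets every functional on [K] extend to [L]; the rest is left exactness of
    Hom. *)
Lemma dual_exact K L M (i : {linear K -> L}) (p : {linear L -> M}) :
  short_exact i p -> Ext1_zero M R^o ->
  exists (p' : {linear dual M -> dual L}) (i' : {linear dual L -> dual K}),
    short_exact p' i' /\ forall phi x, dev (p' phi) x = dev phi (p x).
Proof.
move=> ip EM; have [iI ipE pS] := ip.
have [p' p'E] := dual_map p; have [i' i'E] := dual_map i.
exists p', i'; split=> //; split.
- move=> phi psi e; apply: dual_eq => y; have [x <-] := pS y.
  by rewrite -!p'E e.
- move=> phi; split=> [phi0|[psi <-]]; last first.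
    by apply: dual_eq => x; rewrite i'E p'E (exact0 _ ip) dev0 devr0.
  have [g gE] : exists g : {linear M -> R^o}, forall x, g (p x) = dlin phi x.
    apply: factor_surj => // x /ipE [y <-] /=.
    by rewrite -i'E phi0 dev0.
  have [psi psiE] := dual_ex g; exists psi; apply: dual_eq => x.
  by rewrite p'E psiE gE.
- move=> phi; have [g gE] := EM _ _ _ _ ip (dlin phi).
  have [psi psiE] := dual_ex g; exists psi; apply: dual_eq => x.
  by rewrite i'E psiE gE.
Qed.

Lemma dual_freem n :
  exists coord : 'I_n -> dual (freem n), [/\ forall i x, dev (coord i) x = x i,
    forall psi, psi = \sum_i (dev psi (fbasis i) : R^c) *: coord i,
    projective (dual (freem n)) & finitely_generated (dual (freem n))].
Proof.
have cL i : linear (fun x : freem n => x i : R^o) by [].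
have [coord cE] := choice (fun i => dual_ex (mklin (cL i))).
have sumE psi : psi = \sum_i (dev psi (fbasis i) : R^c) *: coord i.
  apply: dual_eq => x; rewrite dev_sum {1}(fbasis_sum x).
  by rewrite devr_sum; apply: eq_bigr => i _; rewrite cE.
exists coord; split=> //.
  have bL : linear (fun psi : dual (freem n) => (fun i => dev psi (fbasis i)) : @freem R^c n).
    by move=> a x y; apply: funext => i; rewrite dev_lin.
  apply: (@projective_retract _ _ _ (mklin bL) (fsum coord)) (@freem_projective R^c n).
  by move=> psi; rewrite [RHS]sumE.
exists n, coord => psi; exists (fun i => dev psi (fbasis i)); exact: sumE.
Qed.

(** The kernel of a finite free cover of a module with pd* <= 1 is of this kind, and so are its
    further syzygies. *)
Definition acyclic K := finitely_generated K /\ forall j, Ext_zeroS j K R^o.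

Context (hl : left_noetherian R).

Lemma acyclic_cover K : acyclic K -> exists n (p : {linear freem n -> K}),
  surjective p /\ acyclic (subm (kerm p)).
Proof.
move=> [Kfg EK]; have [n [p pS]] := fg_freem Kfg; exists n, p; split=> //; split.
  exact: fg_submodule (freem_fg n).
move=> j; apply: (Ext_zeroS_left (short_exact_ker pS)); last exact: EK.
exact: Ext_zeroS_projective (@freem_projective R n).
Qed.

Context (d : nat).
Context (right_bound : forall L : lmodType R^c, finitely_generated L ->
  Ext_zeroS d L (R^c)^o).
Context (hr : right_noetherian R).

Lemma dual_fg K : acyclic K -> finitely_generated (dual K).
Proof.
move=> KT; have [n [p [pS [Kfg _]]]] := acyclic_cover KT.
have [p' [i' [[p'I _ _] _]]] := dual_exact (short_exact_ker pS) (proj2 KT 0%N).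
have [_ [_ _ _ fgD]] := dual_freem n.
exact: (fg_inj hr p'I).
Qed.

(* [dual K] is an arbitrarily high syzygy, as [0 -> dual K -> dual F -> dual K1 -> 0]. *)
Lemma dual_Ext_zero K : acyclic K -> Ext_zeroS 0 (dual K) (R^c)^o.
Proof.
(* Passing to a syzygy raises the degree in question by one, until [j = d], where the bound for
   right modules applies. *)
suff dE e j : (e + j = d)%N -> forall K, acyclic K -> Ext_zeroS j (dual K) (R^c)^o.
  by apply: (dE d); rewrite addn0.
elim: e j => [|e IHe] j ej L LT.
  by rewrite (_ : j = d) //; apply/right_bound/dual_fg.
have [n [p [pS KT]]] := acyclic_cover LT.
have [p' [i' [pi' _]]] := dual_exact (short_exact_ker pS) (proj2 LT 0%N).
have [_ [_ _ PD _]] := dual_freem n.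
have := IHe j.+1 _ _ KT; rewrite addnS => /(_ ej) EK.
exact: EK PD pi'.
Qed.

(** The dual of the kernel of a free cover has no Ext^1, so [Lam] extends to the dual of the free
    module, where it is evaluation at some [z]; then [p z] represents [Lam]. *)
Lemma acyclic_reflexive K (Lam : {linear dual K -> (R^c)^o}) : acyclic K ->
  exists y, forall phi, Lam phi = dev phi y.
Proof.
move=> KT; have [n [p [pS K1T]]] := acyclic_cover KT.
have [p' [i' [pi' p'E]]] := dual_exact (short_exact_ker pS) (proj2 KT 0%N).
have [g gE] := dual_Ext_zero K1T pi' Lam.
have [coord [_ sumE _ _]] := dual_freem n.
pose z : freem n := \sum_i (g (coord i) : R) *: fbasis i.
exists (p z) => phi; rewrite -p'E -gE; move: (p' phi) => psi.
rewrite {1}(sumE psi) linear_sum devr_sum.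
by apply: eq_bigr => i _; rewrite linearZ.
Qed.
End Dual.

(** * Embedding torsion modules into modules of projective dimension one *)

Section Embedding.
Context {R : pzRingType} {S : R -> Prop}.
Context (hl : left_noetherian R).
Context (hr : right_noetherian R).
Context (hS : ore_set S).
Context (hreg : forall f : R, S f -> non_zero_divisor f).
Implicit Types K M : lmodType R.

Lemma ore_set_converse : ore_set (R := R^c) S.
Proof.
case: hS => S1 SM Sr Sl; split=> //.
by move=> f g Sf Sg; apply: SM.
Qed.

Lemma projective_prod M K : projective M -> projective K -> projective (M * K)%type.
Proof.
move=> PM PK A B p f pS.
have iL : linear (fun x : M => (x, 0) : (M * K)%type).
  by move=> a x y; congr (_, _); rewrite /= scaler0 addr0.
have jL : linear (fun x : K => (0, x) : (M * K)%type).
  by move=> a x y; congr (_, _); rewrite /= scaler0 addr0.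
have [g gE] := PM _ _ p (f \o mklin iL) pS; have [h hE] := PK _ _ p (f \o mklin jL) pS.
have ghL : linear (fun z : (M * K)%type => g z.1 + h z.2).
  by move=> a x y; rewrite /= !linearP scalerDr addrACA.
exists (mklin ghL) => -[x y] /=; rewrite linearD gE hE /= -linearD.
by congr (f (_, _)); rewrite /= ?addr0 ?add0r.
Qed.

(* Clearing denominators: [Ext^1(M, R)] is [S]-torsion. *)
Lemma dual_extend n M (p : {linear freem n -> M}) (phi : dual (subm (kerm p))) :
  torsion S M -> exists f (psi : {linear freem n -> R^o}),
    S f /\ forall x, psi (smval _ x) = dev phi x * f :> R.
Proof.
move=> tM; have /choice [s sP] := fun i => tM (p (fbasis i)).
have sS i : S (s i) by case: (sP i).
have /choice [kap kapE] : forall i, exists k, smval (kerm p) k = s i *: fbasis i.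
  by move=> i; apply: smval_ex; rewrite /= linearZ; case: (sP i).
(* Over the converse ring this is a common right multiple: one [f] brings every
   [dev phi (kap i) * f] into [s i R], and the cofactor [b i] becomes the value of [psi] at the i-th
   basis vector. *)
have [f [fS fP]] := common_left_multiple ore_set_converse (enum 'I_n)
  (fun i => dev phi (kap i) : R^c) sS.
have /choice [b bE] : forall i, exists b : R, dev phi (kap i) * f = s i * b.
  by move=> i; have [|b bE] := fP i; [rewrite mem_enum|exists b].
exists f, (fsum (b : 'I_n -> R^o)); split=> // x.
(* Multiplied by [t], the vector [x] becomes a combination of the [kap i], where both sides are
   known; regularity of [t] allows its cancellation. *)
have [t [tS tP]] := common_left_multiple hS (enum 'I_n) (smval _ x : 'I_n -> R) sS.
have /choice [c cE] : forall i, exists c : R, t * (smval _ x i : R) = c * s i.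
  by move=> i; apply: tP; rewrite mem_enum.
have [tI _] := hreg tS; apply: tI.
have -> : t * (dev phi x * f) = \sum_i c i * (s i * b i).
  under eq_bigr => i _ do rewrite -bE mulrA.
  rewrite -mulr_suml mulrA -devrZ -devr_sum; congr (dev phi _ * f).
  apply: smval_inj; rewrite linearZ linear_sum /= {1}(fbasis_sum (smval _ x)) scaler_sumr.
  by apply: eq_bigr => i _; rewrite linearZ /= kapE !scalerA cE.
rewrite /= mulr_sumr; apply: eq_bigr => i _.
by rewrite [_ *: _]/(_ * _ : R) !mulrA cE.
Qed.

Context (d : nat).
Context (right_bound : forall L : lmodType R^c, finitely_generated L ->
  Ext_zeroS d L (R^c)^o).

(* Write [M = F / K] with [F] free, let the [phi_j] generate [dual K], and extend [phi_j f_j]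
   to [psi_j] on [F], with [f_j] in [S].  The embedding sends [x] to the classes of the
   [psi_j x] modulo [R f_j]; it is injective because [K] is reflexive, and its cokernel has
   no [Ext^2] because the [phi_j] generate. *)
Lemma torsion_embedding M : finitely_generated M -> torsion S M ->
  (forall j, Ext_zeroS j.+1 M R^o) ->
  exists (P M' : lmodType R) (i : {linear M -> P}) (q : {linear P -> M'}),
    [/\ short_exact i q, finitely_generated P, torsion S P, pd_le P 1 &
        forall j, Ext_zeroS j.+1 M' R^o].
Proof.
move=> Mfg tM EM; have [n [p pS]] := fg_freem Mfg.
have ip := short_exact_ker pS.
have KT : acyclic (subm (kerm p)).
  split; first exact: (fg_submodule hl _ (@freem_fg R n)).
  by move=> j; apply: EM (@freem_projective R n) ip.
have [m [phi phiP]] := dual_fg hl hr KT.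
have /choice [f /choice [psi psiP]] := fun j => dual_extend (phi j) tM.
have fS j : S (f j) by case: (psiP j).
have psiE j x : psi j (smval _ x) = dev (phi j) x * f j :> R by case: (psiP j).
have PsiL : linear (fun x => (fun j => psi j x) : freem m).
  by move=> a x y; apply: funext => j; rewrite (linearP (psi j)).
pose Psi := mklin PsiL.
pose theta x := qpi (imm (diag f)) (Psi x).
have thetaL : linear theta by move=> a x y; rewrite /theta !linearP.
have thetaK x : p x = 0 <-> theta x = 0.
  split=> [/(@smval_ex _ _ (kerm p)) [k <-]|].
    apply/qpi_eq0; exists (fun j => dev (phi j) k).
    by apply: funext => j; rewrite /= psiE.
  (* From psi_j x = r_j f_j and y0 = s x in the kernel follows phi_j y0 = s r_j, so every functional
     takes at y0 a value in sR. Dividing by s gives a functional on the dual, which is evaluation at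
     some y by reflexivity; then s x = s y, so x = y lies in the kernel. *)
  move=> /qpi_eq0 [r rE].
  have psix j : psi j x = (r j : R) * f j :> R.
    by rewrite -[LHS]/(Psi x j) -rE.
  have [s [sS sx]] := tM (p x).
  have [y0 y0E] : exists y0, smval (kerm p) y0 = s *: x.
    by apply: smval_ex; rewrite /= linearZ.
  have phiy j : dev (phi j) y0 = s * r j.
    have [_ fI] := hreg (fS j); apply: fI.
    have := psiE j y0; rewrite y0E linearZ /= psix => <-.
    exact: (mulrA s).
  have [sI _] := hreg sS.
  have phi_ex (chi : dual (subm (kerm p))) : exists u : (R^c)^o, dev chi y0 = s * (u : R).
    have [c ->] := phiP chi.
    exists (\sum_i (r i : R) * (c i : R) : R); rewrite dev_sum mulr_sumr.
    by apply: eq_bigr => i _; rewrite phiy mulrA.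
  have [||Lam LamE] := linear_of_rel phi_ex.
  - by move=> a chi u chi' u' e e'; rewrite dev_lin e e' -mulrA -mulrDr.
  - by move=> u; rewrite dev0 => e; apply: sI; rewrite mulr0 e.
  have [y yE] := acyclic_reflexive hl right_bound hr Lam KT.
  have y0y (chi : dual (subm (kerm p))) : dev chi y0 = s * dev chi y.
    by have [u e] := phi_ex chi; rewrite -yE (LamE _ _ e).
  have xy : x = smval _ y.
    apply: funext => i; apply: sI.
    have cL : linear (fun k => smval (kerm p) k i : R^o) by move=> a u v; rewrite linearP.
    have [chi chiE] := dual_ex (mklin cL).
    have := y0y chi; rewrite !chiE /= y0E.
    by [].
  by rewrite xy; apply: (smval_in y).
have [i iE] : exists i : {linear M -> cyclics f}, forall x, i (p x) = mklin thetaL x.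
  by apply: factor_surj => // x /thetaK.
have iI : injective i.
  by apply: linear_inj => y; have [x <-] := pS y; rewrite iE => /thetaK.
have iq := short_exact_coker iI; have [_ iqE qS] := iq.
exists (cyclics f), (quom (imm i)), i, (qpi (imm i)); split=> //.
- exact: cyclics_fg.
- exact: (cyclics_torsion hS fS).
- exact: (cyclics_pd fS hreg).
have [diagI _ _] := cyclics_exact fS hreg.
pose rho : {linear freem m -> quom (imm i)} :=
  mklin (linearP (qpi (imm i) \o qpi (imm (diag f)))).
have rhoS : surjective rho.
  by move=> z; have [u <-] := qS z; have [x <-] := qpi_surj u; exists x.
have rhoE v : rho v = 0 <-> exists x c, v = Psi x + diag f c.
  split=> [/iqE [y]|[x [c ->]]].
    have [x <-] := pS y; rewrite iE => e.
    have /qpi_eq0 [c cE] : qpi (imm (diag f)) (v - Psi x) = 0.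
      by apply/eqP; rewrite linearB subr_eq0; apply/eqP/(esym e).
    by exists x, c; rewrite cE addrC subrK.
  apply/iqE; exists (p x); rewrite iE.
  have dc : qpi (imm (diag f)) (diag f c) = 0 by apply/qpi_eq0; exists c.
  by rewrite -[RHS]/(qpi (imm (diag f)) (Psi x + diag f c)) linearD dc addr0.
pose W : lmodType R := (freem n * freem m)%type.
have sigL : linear (fun w : W => Psi w.1 + diag f w.2).
  by move=> a x y; rewrite (linearP Psi) (linearP (diag f)) scalerDr addrACA.
have [sig sigE] := @lift_subm _ _ _ (kerm rho) (mklin sigL)
  (fun w => (rhoE _).2 (ex_intro _ w.1 (ex_intro _ w.2 erefl))).
(* The kernel of [sig] is a copy of [subm (kerm p)]: the second component cancels psi_j k = (phi_j
   k) f_j. *)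
have jL : linear (fun k => (smval (kerm p) k, (fun j => - dev (phi j) k : R^o)) : W).
  move=> a x y; congr (_, _); first exact: linearP.
  apply: funext => j.
  change (- dev (phi j) (a *: x + y) = a * - dev (phi j) x - dev (phi j) y :> R).
  by rewrite mulrN -opprD; congr (- _); apply: dev_linear.
have jsig : short_exact (mklin jL) sig.
  split.
  - by move=> x y [/smval_inj].
  - move=> w; split=> [w0|[k <-]]; last first.
      apply: smval_inj; rewrite sigE linear0 /=; apply: funext => j.
      rewrite fctE psiE mulNr; exact: subrr.
    have := sigE w; rewrite w0 linear0 /= => /esym e.
    have /thetaK /(@smval_ex _ _ (kerm p)) [k kE] : theta w.1 = 0.
      apply/qpi_eq0; exists (- w.2); rewrite linearN.
      by apply/eqP; rewrite eq_sym -subr_eq0 opprK; apply/eqP.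
    exists k; rewrite /= kE [RHS]surjective_pairing; congr (_, _).
    apply: diagI; apply: (addrI (Psi w.1)); rewrite e -kE.
    apply: funext => j; rewrite fctE /= psiE mulNr; exact: subrr.
  - move=> v; have [x [c vE]] := (rhoE _).1 (smval_in v).
    by exists (x, c); apply: smval_inj; rewrite sigE vE.
have PW : projective W by apply: projective_prod; apply: freem_projective.
move=> j; apply: (Ext_zeroS_syzygy (short_exact_ker rhoS)).
  exact: freem_projective.
(* For positive [j], dimension shifting along [jsig] ends in the acyclic kernel of [p]. For [j = 0],
   a functional sum_l phi_l c_l on that kernel must extend to [W]: minus [fsum c] on the second
   factor does it, the sign undoing that of [jsig]. *)
case: j => [|j]; last exact: (Ext_zeroS_syzygy jsig PW (proj2 KT j)).
apply: (Ext1_zero_quotient jsig); first exact: (Ext_zeroS_projective 0).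
move=> chi; have [chi' chiE] := dual_ex chi; have [c cE] := phiP chi'.
have gL : linear (fun w : W => - fsum (c : 'I_m -> R^o) w.2).
  by move=> a x y; rewrite (linearP (fsum _)) opprD -scalerN.
exists (mklin gL) => k; rewrite -chiE cE dev_sum /= -sumrN.
by apply: eq_bigr => l _; rewrite -scaleNr opprK.
Qed.
End Embedding.

(** * Pushouts and extensions *)

Section MoreExact.
Context {R : pzRingType}.
Implicit Types A B C M N P Y Z : lmodType R.

Lemma ses_pushout N P M P' M' (i : {linear N -> P}) (p : {linear P -> M})
    (i' : {linear N -> P'}) (p' : {linear P' -> M'}) :
  short_exact i p -> short_exact i' p' ->
  exists Y (a : {linear P -> Y}) (b : {linear Y -> M'})
    (a' : {linear P' -> Y}) (b' : {linear Y -> M}),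
    short_exact a b /\ short_exact a' b'.
Proof.
move=> ip ip'; have [iI ipE pS] := ip; have [i'I ip'E p'S] := ip'.
pose W : lmodType R := (P * P')%type.
have uL : linear (fun n => (i n, - i' n) : W).
  by move=> c x y; rewrite !linearP; congr (_, _); rewrite opprD -scalerN.
pose U := imm (mklin uL).
have aL : linear (fun x => (x, 0) : W).
  by move=> c x y; congr (_, _); rewrite /= scaler0 addr0.
have a'L : linear (fun x => (0, x) : W).
  by move=> c x y; congr (_, _); rewrite /= scaler0 addr0.
have bL : linear (fun w : W => p' w.2) by move=> c x y; rewrite /= linearP.
have b'L : linear (fun w : W => p w.1) by move=> c x y; rewrite /= linearP.
have [b bE] : exists b : {linear quom U -> M'}, forall w, b (qpi U w) = mklin bL w.
  apply: factor_surj; first exact: qpi_surj.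
  by move=> _ /qpi_eq0 [n <-] /=; rewrite linearN (exact0 _ ip') oppr0.
have [b' b'E] : exists b' : {linear quom U -> M}, forall w, b' (qpi U w) = mklin b'L w.
  apply: factor_surj; first exact: qpi_surj.
  by move=> _ /qpi_eq0 [n <-] /=; rewrite (exact0 _ ip).
exists (quom U), (mklin (linearP (qpi U \o mklin aL))), b,
  (mklin (linearP (qpi U \o mklin a'L))), b'.
split; split.
- apply: linear_inj => x /qpi_eq0 [n [<- /eqP]].
  by rewrite oppr_eq0 => /eqP/(inj_eq0 i'I) ->; rewrite linear0.
- move=> y; have [[x z] <-] := qpi_surj y; rewrite bE /=; split=> [/ip'E [n <-]|[x' e]].
    exists (x + i n); apply/eqP; rewrite -subr_eq0 -linearB; apply/eqP/qpi_eq0.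
    by exists n; congr (_, _); rewrite /= ?(addrC x) ?addrK ?sub0r.
  by rewrite -[LHS]/(mklin bL (x, z)) -bE -e bE /= linear0.
- by move=> y; have [x <-] := p'S y; exists (qpi U (0, x)); rewrite bE.
- apply: linear_inj => x /qpi_eq0 [n [/(inj_eq0 iI) -> <-]].
  by rewrite linear0 oppr0.
- move=> y; have [[x z] <-] := qpi_surj y; rewrite b'E /=; split=> [/ipE [n <-]|[x' e]].
    exists (z + i' n); apply/eqP; rewrite eq_sym -subr_eq0 -linearB; apply/eqP/qpi_eq0.
    by exists n; congr (_, _); rewrite /= ?subr0 ?opprD ?addNKr ?addrA ?subrr ?sub0r.
  by rewrite -[LHS]/(mklin b'L (x, z)) -b'E -e b'E /= linear0.
- by move=> y; have [x <-] := pS y; exists (qpi U (x, 0)); rewrite b'E.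
Qed.

(** [Z] is [P] modulo [A], with [C] embedded as [B] modulo [A]. *)
Lemma ses_quotient A B C P M (i : {linear A -> B}) (p : {linear B -> C})
    (j : {linear B -> P}) (q : {linear P -> M}) :
  short_exact i p -> short_exact j q ->
  exists Z (b : {linear P -> Z}) (c : {linear C -> Z}) (e : {linear Z -> M}),
    short_exact (j \o i) b /\ short_exact c e.
Proof.
move=> [iI ipE pS] [jI jqE qS]; pose b := qpi (imm (j \o i)).
have [c cE] : exists c : {linear C -> quom (imm (j \o i))}, forall x, c (p x) = (b \o j) x.
  by apply: factor_surj => // x /ipE [a <-]; apply/qpi_eq0; exists a.
have [e eE] : exists e : {linear quom (imm (j \o i)) -> M}, forall x, e (b x) = q x.
  by apply: factor_surj; [exact: qpi_surj|move=> _ /qpi_eq0 [a <-]; apply/jqE; exists (i a)].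
exists (quom (imm (j \o i))), b, c, e; split.
  by apply: short_exact_coker => x y /jI/iI.
split.
- apply: linear_inj => y; have [x <-] := pS y; rewrite cE => /qpi_eq0 [a /jI ax].
  by apply/ipE; exists a.
- move=> z; have [x <-] := @qpi_surj _ _ (imm (j \o i)) z; rewrite eE.
  split=> [/jqE [y <-]|[y e0]]; first by exists (p y); rewrite cE.
  have [y' yE] := pS y; rewrite -eE -[b x]e0 -yE cE /= eE; apply/jqE.
  by exists y'.
- by move=> m; have [x <-] := qS m; exists (b x); rewrite eE.
Qed.

Lemma fg_extension A B C (i : {linear A -> B}) (p : {linear B -> C}) :
  short_exact i p -> finitely_generated A -> finitely_generated C -> finitely_generated B.
Proof.
move=> [iI ipE pS] /fgP [s sP] /fgP [t tP]; apply/fgP.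
have [t' t'E] : exists t', map p t' = t.
  elim: t {tP} => [|v t [t' <-]]; first by exists [::].
  by have [v' <-] := pS v; exists (v' :: t').
have liftP (r : seq B) y : in_span (map p r) y -> exists x, p x = y /\ in_span r x.
  elim: r y => [|v r IHr] y /=; first by move=> ->; exists 0; rewrite linear0.
  move=> [a /IHr [x [px xr]]]; exists (a *: v + x); rewrite linearP px addrC subrK.
  by split=> //; exists a; rewrite addrC addKr.
exists (map i s ++ t') => x.
have [|y [pxy yt]] := liftP t' (p x); first by rewrite t'E.
have /ipE [z zE] : p (x - y) = 0 by rewrite linearB /= pxy subrr.
rewrite -[x](subrK y) -zE; apply: in_span_cat => //.
exact: in_span_map.
Qed.

Lemma torsion_extension (S : R -> Prop) A B C (i : {linear A -> B}) (p : {linear B -> C}) :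
  (forall f g, S f -> S g -> S (f * g)) ->
  short_exact i p -> torsion S A -> torsion S C -> torsion S B.
Proof.
move=> SM [iI ipE pS] tA tC x; have [s [sS sx]] := tC (p x).
have /ipE [y yE] : p (s *: x) = 0 by rewrite linearZ.
have [t [tS ty]] := tA y; exists (t * s); split; first exact: SM.
by rewrite -scalerA -yE -linearZ ty linear0.
Qed.

(** Index [j] of [Ext_zeroS] stands for degree j+1, so the degrees above [k] are the indices from
    [k] on; degree 0 never exceeds the natural number [k]. *)
Lemma pdstar_leP M (k : nat) :
  pdstar_le M k <-> forall j, (k <= j)%N -> Ext_zeroS j M R^o.
Proof.
split=> [Mk j kj|Mk [//|j]].
  apply/Ext_zero_S; apply: contrapT => /Mk.
  by rewrite lez_nat ltnNge kj.
rewrite /E_zero Ext_zero_S lez_nat => Mj.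
by have [kj|//] := leqP k j; case: Mj; apply: Mk.
Qed.
End MoreExact.

(** * Exact sequences of torsion modules *)

Section TorsionModules.
Context {R : pzRingType} {S : R -> Prop}.
Implicit Types A B C M N P Q X Y Z : catM S.

Definition ses A B C := exists (f : {linear A -> B}) (g : {linear B -> C}), short_exact f g.

Definition Ext_above k M := forall j, (k <= j)%N -> Ext_zeroS j M R^o.

Lemma Ext_above_mid k A B C : ses A B C -> Ext_above k A -> Ext_above k C -> Ext_above k B.
Proof. by move=> [f [g fg]] DA DC j kj; apply: (Ext_zeroS_mid fg); [apply: DA|apply: DC]. Qed.

Lemma Ext_above_left k A B C : ses A B C -> Ext_above k B -> Ext_above k.+1 C -> Ext_above k A.
Proof. by move=> [f [g fg]] DB DC j kj; apply: (Ext_zeroS_left fg); [apply: DB|apply: DC]. Qed.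

Lemma Ext_above_weak k l M : (k <= l)%N -> Ext_above k M -> Ext_above l M.
Proof. by move=> kl DM j lj; apply: DM (leq_trans kl lj). Qed.

Lemma inP_Ext_above P : inP P -> Ext_above 1 P.
Proof. by move=> PP j j1; apply: Ext_zeroS_pd PP. Qed.

Lemma inP_Q P : inP P -> inQ P.
Proof. by exists 1%N. Qed.

Lemma inQ_left A B C : ses A B C -> inQ B -> inQ C -> inQ A.
Proof.
move=> [f [g fg]] [k kB] [l lC]; exists (maxn k l); apply/pd_leP => N.
by apply: (Ext_zeroS_left fg); [apply: Ext_zeroS_pd kB|apply: Ext_zeroS_pd lC];
  rewrite ?leq_maxl // leqW ?leq_maxr.
Qed.

Lemma inQ_right A B C : ses A B C -> inQ A -> inQ B -> inQ C.
Proof.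
move=> [f [g fg]] [k kA] [l lB]; exists (maxn k l).+1; apply/pd_leP => N.
by apply: (Ext_zeroS_right fg); [apply: Ext_zeroS_pd kA|apply: Ext_zeroS_pd lB];
  rewrite ?leq_maxl // leqW ?leq_maxr.
Qed.

(** The degenerate sequences that normalise an invariant: the first forces the value 1 on [Z], and
    the other two, as a cover and as an embedding, make shifting inverse to the invariant on modules
    of finite pd. *)
Lemma zero_object M : exists Z, [/\ inP Z, ses Z Z Z, ses Z M M & ses M M Z].
Proof.
pose F := @freem R 0.
have F0 (x : F) : x = 0 by apply: funext => -[].
have tF : torsion S F.
  (* The torsion of [M] at 0 supplies an element of [S]. *)
  have [s [sS _]] := catM_torsion (0 : M).
  by move=> x; exists s; rewrite (F0 x) scaler0.
pose Z := CatM (@freem_fg R 0) tF.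
have idE (N : lmodType R) (i : {linear F -> N}) : short_exact i (mklin (linearP (@idfun N))).
  split=> [x y _|y|y]; [by rewrite (F0 x)| |by exists y].
  by split=> /= [->|[x <-]]; [exists 0; rewrite linear0|rewrite (F0 x) linear0].
have oL (N : lmodType R) : linear (\0 : N -> F) by move=> a x y; rewrite /= scaler0 addr0.
exists Z; split.
- apply/pd_leP => N; exact: (Ext_zeroS_projective _ _ (@freem_projective R 0)).
- by exists (mklin (oL F)), (mklin (linearP (@idfun F))); apply: idE.
- by exists (fsum (fun=> 0)), (mklin (linearP (@idfun M))); apply: idE.
- exists (mklin (linearP (@idfun M))), (mklin (oL M)); split=> [//|y|y].
    by split=> // _; exists y.
  by exists 0; rewrite (F0 y).
Qed.

Context (hl : left_noetherian R).
Context (hS : ore_set S).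

Lemma cat_preimage N P M A C : ses N P M -> ses A M C ->
  exists Z, ses Z P C /\ ses N Z A.
Proof.
move=> [j [q jq]] [i [p ip]].
have [Z [a [b [c [ac bc _ _]]]]] := ses_preimage jq ip.
have [aI _ _] := ac.
exists (CatM (fg_inj hl aI (catM_fg P)) (torsion_inj aI (@catM_torsion _ _ P))).
split; first by exists a, (mklin (linearP (p \o q))).
by exists b, c.
Qed.

Lemma cat_extension N P (X : lmodType R) (f : {linear N -> X}) (g : {linear X -> P}) :
  short_exact f g -> exists X' : catM S, catM_mod X' = X.
Proof.
move=> fg.
by exists (CatM (fg_extension fg (catM_fg N) (catM_fg P))
  (torsion_extension (ore_mul hS) fg (@catM_torsion _ _ N) (@catM_torsion _ _ P))).
Qed.

Lemma cat_pullback N P M N' P' : ses N P M -> ses N' P' M ->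
  exists X, ses N X P' /\ ses N' X P.
Proof.
move=> [i [p ip]] [i' [p' ip']].
have [X [a [b [h [ab _ _ /(_ _ _ ip') [k [kh _]]]]]]] := ses_pullback p' ip.
(* Eliminating [XE] gives the maps the carrier of [X'] as source or target, with no transport. *)
have [X' XE] := cat_extension ab; case: _ / XE a b h ab k kh => a b h ab k kh.
by exists X'; split; [exists a, b|exists k, h].
Qed.

Lemma cat_pushout N P M P' M' : ses N P M -> ses N P' M' ->
  exists Y, ses P Y M' /\ ses P' Y M.
Proof.
move=> [i [p ip]] [i' [p' ip']].
have [Y [a [b [a' [b' [ab ab']]]]]] := ses_pushout ip ip'.
have [Y' YE] := cat_extension ab; case: _ / YE a b a' b' ab ab' => a b a' b' ab ab'.
by exists Y'; split; [exists a, b|exists a', b'].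
Qed.

Lemma cat_quotient A B C P M : ses A B C -> ses B P M ->
  exists Z, ses A P Z /\ ses C Z M.
Proof.
move=> [i [p ip]] [j [q jq]].
have [Z [b [c [e [bE ce]]]]] := ses_quotient ip jq.
have [Z' ZE] := cat_extension ce; case: _ / ZE b c e bE ce => b c e bE ce.
by exists Z'; split; [exists (mklin (linearP (j \o i))), b|exists c, e].
Qed.

Lemma inQ_pd_le k P : inQ P -> Ext_above k P -> pd_le P k.
Proof. by move=> QP DP; apply: pd_le_of_Ext => //; apply: catM_fg. Qed.

Context (hreg : forall f : R, S f -> non_zero_divisor f).

Lemma cat_cover M : exists N P, ses N P M /\ inP P.
Proof.
have [P [p [Pfg tP pdP pS]]] := torsion_cover hS hreg (catM_fg M) (@catM_torsion _ _ M).
have ip := short_exact_ker pS; have [iI _ _] := ip.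
exists (CatM (fg_inj hl iI Pfg) (torsion_inj iI tP)), (CatM Pfg tP); split=> //.
by exists (smval (kerm p)), p.
Qed.

Context (hr : right_noetherian R).
Context (d : nat).
Context (right_bound : forall L : lmodType R^c, finitely_generated L ->
  Ext_zeroS d L (R^c)^o).

Lemma cat_embed M : Ext_above 1 M -> exists P N, [/\ ses M P N, inP P & Ext_above 1 N].
Proof.
move=> DM; have [|P [N [i [q [iq Pfg tP pdP EN]]]]] :=
  torsion_embedding hl hr hS hreg right_bound (catM_fg M) (@catM_torsion _ _ M).
  by move=> j; apply: DM.
have [_ _ qS] := iq.
exists (CatM Pfg tP), (CatM (fg_surj qS Pfg) (torsion_surj qS tP)); split=> //.
  by exists i, q.
by case.
Qed.
End TorsionModules.

(** * The shifted invariants *)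

Section Shift.
Context {R : pzRingType} {S : R -> Prop}.
Context (hl : left_noetherian R).
Context (hr : right_noetherian R).
Context (hS : ore_set S).
Context (hreg : forall f : R, S f -> non_zero_divisor f).
Context (d : nat).
Context (right_bound : forall L : lmodType R^c, finitely_generated L ->
  Ext_zeroS d L (R^c)^o).
Context (left_bound : forall M : catM S, Ext_above d.+1 M).
Context {Omega : monoidType}.
Context (hOmega : commutative (fun x y : Omega => (x * y)%g)).
Implicit Types (A B C M N P Q X Y Z : catM S) (G : catM S -> Omega) (x y z w : Omega).
Local Open Scope group_scope.

Lemma om_mulC x y : x * y = y * x. Proof. exact: hOmega. Qed.

Lemma om_mulAC x y z : x * y * z = x * z * y.
Proof. by rewrite -!mulgA (om_mulC y). Qed.

Lemma om_cancel z x y : invertible z -> x * z = y * z -> x = y.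
Proof.
by move=> [w [zw _]] e; rewrite -[x]mulg1 -[y]mulg1 -zw !mulgA e.
Qed.

Lemma invertible_l x y : invertible (x * y) -> invertible x.
Proof.
move=> [w [e e']]; exists (y * w); rewrite mulgA e; split=> //.
by rewrite om_mulC mulgA e.
Qed.

(** [P] ranges over modules of finite pd, not only pd <= 1, because the diagrams produce kernels and
    cokernels of which nothing better is known. *)
Record fitting k G : Prop := Fitting {
  fitting_unit : forall P, inQ P -> Ext_above k P -> invertible (G P);
  fitting_quot : forall A B P, inQ P -> Ext_above k P -> Ext_above k A -> Ext_above k B ->
    ses A B P -> G B = G P * G A;
  fitting_sub : forall P B C, inQ P -> Ext_above k P -> Ext_above k B -> Ext_above k C ->
    ses P B C -> G B = G P * G C
}.

Lemma fitting_weak k l G : (k <= l)%N -> fitting l G -> fitting k G.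
Proof.
move=> kl [Gu Gq Gs]; have w M := @Ext_above_weak _ _ k l M kl.
by split=> [P|A B P|P B C] *; [apply: Gu|apply: Gq|apply: Gs]; auto.
Qed.

Lemma fitting_zero k G Z : fitting k G -> (0 < k)%N -> inP Z -> ses Z Z Z -> G Z = 1.
Proof.
move=> GF k0 PZ ZZ; have DZ := Ext_above_weak k0 (inP_Ext_above PZ); have QZ := inP_Q PZ.
apply: (om_cancel (fitting_unit GF QZ DZ)); rewrite mul1g.
by rewrite -(fitting_quot GF QZ DZ DZ DZ ZZ).
Qed.

Definition shift_up_rel G M w := exists N P, [/\ ses N P M, inP P & w * G P = G N].

Definition shift_up G M : Omega :=
  if pselect (exists w, shift_up_rel G M w) is left e then projT1 (cid e) else 1.

(** With [G] as F^<n>, this is the shift rule solved for F^<n-1>(N); the cokernel [M] is kept in the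
    range where [G] is controlled. *)
Definition shift_down_rel G N w :=
  exists P M, [/\ ses N P M, inP P, Ext_above 1 M & w * G P = G M].

Definition shift_down G N : Omega :=
  if pselect (exists w, shift_down_rel G N w) is left e then projT1 (cid e) else 1.

Lemma inP_unit k G P : (0 < k)%N -> fitting k G -> inP P -> invertible (G P).
Proof.
by move=> k0 GF PP; apply: (fitting_unit GF (inP_Q PP)); apply: Ext_above_weak (inP_Ext_above PP).
Qed.

Lemma divides x y : invertible x -> exists w, w * x = y.
Proof. by move=> [x' [_ x'x]]; exists (y * x'); rewrite -mulgA x'x mulg1. Qed.

(** * Shifting up along covers *)

Section Up.
Context (k : nat).
Context (k0 : (0 < k)%N).
Context (G : catM S -> Omega).
Context (GF : fitting k G).

(** The source of the gain in range: the kernel of a cover satisfies the bound lowered by one. *)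
Lemma cover_Ext_above M : Ext_above k.+1 M ->
  exists N P, [/\ ses N P M, inP P, Ext_above k P & Ext_above k N].
Proof.
move=> DM; have [N [P [NPM PP]]] := cat_cover hl hS hreg M.
have DP := Ext_above_weak k0 (inP_Ext_above PP); exists N, P; split=> //.
exact: Ext_above_left NPM DP DM.
Qed.

Lemma shift_upE N P M : Ext_above k.+1 M -> ses N P M -> inQ P -> Ext_above k P ->
  shift_up G M * G P = G N.
Proof.
move=> DM NPM QP DP; rewrite /shift_up; case: pselect => [e|]; last first.
  have [N0 [P0 [NPM0 PP0 _ _]]] := cover_Ext_above DM.
  have [w wE] := divides (G N0) (inP_unit k0 GF PP0).
  by case; exists w, N0, P0.
case: (cid e) => w [N0 [P0 [NPM0 PP0 wE]]] /=; rewrite {e}.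
have DP0 := Ext_above_weak k0 (inP_Ext_above PP0).
have DN := Ext_above_left NPM DP DM; have DN0 := Ext_above_left NPM0 DP0 DM.
have [X [NX NX0]] := cat_pullback hS NPM NPM0.
have DX := Ext_above_mid NX DN DP0.
have e1 := fitting_quot GF (inP_Q PP0) DP0 DN DX NX.
have e2 := fitting_quot GF QP DP DN0 DX NX0.
apply: (om_cancel (inP_unit k0 GF PP0)).
by rewrite om_mulAC wE om_mulC -e2 e1 om_mulC.
Qed.

Lemma shift_up_self P : inQ P -> Ext_above k P -> shift_up G P * G P = 1.
Proof.
move=> QP DP; have [Z [PZ ZZ ZP _]] := zero_object P.
by rewrite (shift_upE _ ZP) // ?(fitting_zero GF k0) //; apply: Ext_above_weak DP.
Qed.

Lemma shift_up_fitting : fitting k.+1 (shift_up G).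
Proof.
have GU P : inQ P -> Ext_above k P -> invertible (G P) by apply: fitting_unit.
split.
- move=> P QP DP; have [N [P0 [NPM PP0 DP0 DN]]] := cover_Ext_above DP.
  apply: (@invertible_l _ (G P0)); rewrite (shift_upE DP NPM (inP_Q PP0) DP0).
  by apply: GU => //; apply: inQ_left NPM _ QP; apply: inP_Q.
- move=> A B P QP DP DA DB ABP.
  have [N [Q [NQB /inP_Q QQ DQ DN]]] := cover_Ext_above DB.
  (* [Q'] is the preimage of [A] in [Q]: it covers [A] with kernel [N], and is itself the kernel of
     [Q -> P]. *)
  have [Q' [QQP NQA]] := cat_preimage hl NQB ABP.
  have DQ' := Ext_above_left QQP DQ DP; have QQ' := inQ_left QQP QQ QP.
  apply: (om_cancel (GU _ QQ DQ)).
  rewrite (shift_upE DB NQB) // om_mulAC (shift_upE DP QQP) // om_mulC.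
  by rewrite (shift_upE DA NQA).
- move=> P B C QP DP DB DC PBC.
  have [N [Q [NQB /inP_Q QQ DQ DN]]] := cover_Ext_above DB.
  have [Q' [QQC NQP]] := cat_preimage hl NQB PBC.
  have DQ' := Ext_above_left QQC DQ DC.
  (* Here [Q'] need not satisfy [inQ], so [shift_upE] does not apply to [Q' -> P]. A cover [P0] of
     [P] has its kernel [L] in [inQ], and evaluating [G] on the fibre product [X] in two ways gives
     the same relation for [Q']. *)
  have [L [P0 [LPP /inP_Q QP0 DP0 DL]]] := cover_Ext_above DP.
  have QL := inQ_left LPP QP0 QP.
  have [X [NX LX]] := cat_pullback hS NQP LPP.
  have DX := Ext_above_mid NX DN DP0.
  have eX : G P0 * G N = G L * G Q'.
    by rewrite -(fitting_quot GF QP0 DP0 DN DX NX) (fitting_sub GF QL DL DX DQ' LX).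
  have e : shift_up G P * G Q' = G N.
    apply: (om_cancel (GU _ QP0 DP0)).
    by rewrite om_mulAC (shift_upE DP LPP) // -eX om_mulC.
  apply: (om_cancel (GU _ QQ DQ)).
  by rewrite (shift_upE DB NQB) // -mulgA (shift_upE DC QQC) // e.
Qed.

End Up.

Lemma shift_up_ext k G G' : (0 < k)%N -> fitting k G -> fitting k G' ->
  (forall M, Ext_above k M -> G M = G' M) ->
  forall M, Ext_above k.+1 M -> shift_up G M = shift_up G' M.
Proof.
move=> k0 GF GF' GG' M DM; have [N [P [NPM PP DP DN]]] := cover_Ext_above k0 DM.
apply: (om_cancel (inP_unit k0 GF PP)).
rewrite (shift_upE k0 GF DM NPM (inP_Q PP) DP) GG' // GG' //.
by rewrite (shift_upE k0 GF' DM NPM (inP_Q PP) DP).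
Qed.

(** * Shifting down along embeddings *)

Section Down.
Context (G : catM S -> Omega).
Context (GF : fitting 1 G).
Let GU P : inQ P -> Ext_above 1 P -> invertible (G P) := @fitting_unit 1 G GF P.
Let embed := cat_embed hl hS hreg hr right_bound.

Lemma shift_downE N P M : Ext_above 1 N -> ses N P M -> inQ P ->
  Ext_above 1 P -> Ext_above 1 M ->
  shift_down G N * G P = G M.
Proof.
move=> DN NPM QP DP DM; rewrite /shift_down; case: pselect => [e|]; last first.
  have [P0 [M0 [NPM0 PP0 DM0]]] := embed DN.
  have [w wE] := divides (G M0) (GU (inP_Q PP0) (inP_Ext_above PP0)).
  by case; exists w, P0, M0.
case: (cid e) => w [P0 [M0 [NPM0 PP0 DM0 wE]]] /=; rewrite {e}.
have DP0 := inP_Ext_above PP0; have QP0 := inP_Q PP0.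
have [Y [PY PY0]] := cat_pushout hS NPM NPM0.
have DY := Ext_above_mid PY DP DM0.
have e1 := fitting_sub GF QP DP DY DM0 PY.
have e2 := fitting_sub GF QP0 DP0 DY DM PY0.
apply: (om_cancel (GU QP0 DP0)).
by rewrite om_mulAC wE om_mulC -e1 e2 om_mulC.
Qed.

Lemma shift_down_self P : inQ P -> Ext_above 1 P -> shift_down G P * G P = 1.
Proof.
move=> QP DP; have [Z [PZ ZZ _ PPZ]] := zero_object P.
by rewrite (shift_downE DP PPZ) ?(fitting_zero GF) //; apply: inP_Ext_above.
Qed.

Lemma shift_down_fitting : fitting 1 (shift_down G).
Proof.
split.
- move=> P QP DP; apply: (@invertible_l _ (G P)).
  by rewrite shift_down_self //; exists 1; rewrite mulg1.
- move=> A B P QP DP DA DB ABP.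
  have [Q [M [BQM PQ DM]]] := embed DB.
  (* [Z] is [Q] modulo [A]; it contains [P] with quotient [M], so the sub rule for [G] yields the
     quotient rule for its shift. *)
  have [Z [AQZ PZM]] := cat_quotient hS ABP BQM.
  have [QQ DQ] := (inP_Q PQ, inP_Ext_above PQ).
  have DZ := Ext_above_mid PZM DP DM.
  apply: (om_cancel (GU QQ DQ)).
  rewrite (shift_downE DB BQM) // -mulgA (shift_downE DA AQZ) //.
  by rewrite (fitting_sub GF QP DP DZ DM PZM) mulgA shift_down_self // mul1g.
- move=> P B C QP DP DB DC PBC.
  have [Q [M [BQM PQ DM]]] := embed DB.
  have [Z [PQZ CZM]] := cat_quotient hS PBC BQM.
  have [QQ DQ] := (inP_Q PQ, inP_Ext_above PQ).
  have DZ := Ext_above_mid CZM DC DM; have QZ := inQ_right PQZ QP QQ.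
  apply: (om_cancel (GU QQ DQ)).
  rewrite (shift_downE DB BQM) // om_mulAC (shift_downE DP PQZ) // om_mulC.
  by rewrite (shift_downE DC CZM).
Qed.

(** One sequence [N -> P -> M] is read both ways, and the two factors at [P] cancel. This supplies
    [shiftC_step] at the indices [n <= 0]. *)
Lemma shift_up_down M : Ext_above 1 M -> shift_up (shift_down G) M = G M.
Proof.
move=> DM; have DM2 : Ext_above 2 M by apply: Ext_above_weak DM.
have [N [P [NPM PP DP DN]]] := cover_Ext_above (ltn0Sn 0) DM2.
have e := shift_upE (ltn0Sn 0) shift_down_fitting DM2 NPM (inP_Q PP) DP.
by rewrite -(shift_downE DN NPM (inP_Q PP) DP DM) -e -mulgA shift_down_self ?mulg1 //;
  apply: inP_Q.
Qed.

End Down.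

(** * The family on all torsion modules *)

Section Family.
Context (G0 : catM S -> Omega).
Context (GF0 : fitting 1 G0).

Definition shiftC (n : int) : catM S -> Omega :=
  match n with Posz n => iter n shift_up G0 | Negz n => iter n.+1 shift_down G0 end.

Lemma shiftC_fitting n : fitting 1 (shiftC n).
Proof.
case: n => n /=.
  elim: n => //= n IHn; apply: (@fitting_weak 1 2) => //.
  exact: shift_up_fitting.
by elim: n => [|n IHn]; apply: shift_down_fitting.
Qed.

Lemma shiftC_step n M : Ext_above 1 M -> shift_up (shiftC (n - 1)) M = shiftC n M.
Proof.
case: n => [[|n]|n] DM; first exact: shift_up_down.
  by rewrite (_ : (n.+1%:Z - 1 = n%:Z)%R) // intS addrC addKr.
rewrite (_ : (Negz n - 1)%R = Negz n.+1); last by rewrite !NegzE -opprD -PoszD addn1.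
exact: (shift_up_down (shiftC_fitting (Negz n))).
Qed.

Lemma iter_up_fitting e n : fitting e.+1 (iter e shift_up (shiftC n)).
Proof.
elim: e => [|e IHe] /=; first exact: shiftC_fitting.
exact: shift_up_fitting.
Qed.

(** Starting [e] indices below [n] and shifting up [e] times arrives at index [n] with the range
    widened to pd* <= e+1. *)
Definition shiftM e (n : int) := iter e shift_up (shiftC (n - e%:Z)%R).

(** The right-hand side is [shiftM e.+1 n M], so this is independence of the starting index: a start
    one lower is undone by one more shift up. *)
Lemma shiftM_step e n M : Ext_above e.+1 M -> shiftM e n M = shift_up (shiftM e (n - 1)) M.
Proof.
rewrite /shiftM -iterS iterSr (_ : (n - 1 - e%:Z = n - e%:Z - 1)%R); last by rewrite addrAC.
elim: e (n - e%:Z)%R M => [|e IHe] m M DM /=; first by rewrite shiftC_step.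
apply: shift_up_ext DM => //; first exact: iter_up_fitting.
  rewrite -iterSr; apply: (@fitting_weak _ e.+2) => //; exact: (iter_up_fitting e.+1).
exact: IHe.
Qed.

Lemma shiftM_C e n M : Ext_above 1 M -> shiftM e n M = shiftC n M.
Proof.
elim: e n M => [|e IHe] n M DM; first by rewrite /shiftM subr0.
rewrite -(shiftC_step n DM) /shiftM iterS.
rewrite (_ : (n - e.+1%:Z = n - 1 - e%:Z)%R); last by rewrite intS opprD addrA.
apply: (@shift_up_ext 1) => //; last by apply: Ext_above_weak DM.
- by apply: fitting_weak (iter_up_fitting e _).
- exact: shiftC_fitting.
- by move=> M' DM'; apply: IHe.
Qed.
End Family.

(** * Uniqueness of the family *)

Section Uniqueness.
Context (F : catC S -> Omega).

Lemma family_zero H Z n : shift_family F H -> inQ Z -> ses Z Z Z -> H n Z = 1.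
Proof.
move=> HF QZ [f [g fg]]; apply: (om_cancel (sf_unit HF QZ n)).
by rewrite mul1g -(sf_quot HF QZ fg).
Qed.

Lemma family_self H P n : shift_family F H -> inQ P -> H n P * H (n - 1)%R P = 1.
Proof.
move=> HF QP; have [Z [/inP_Q QZ ZZ _ [f [g PPZ]]]] := zero_object P.
by rewrite -(sf_shift HF QP PPZ) (family_zero _ HF QZ ZZ).
Qed.

Lemma family_shift H N P M n : shift_family F H -> inQ P -> ses N P M ->
  H n M * H (n - 1)%R P = H (n - 1)%R N.
Proof.
move=> HF QP [f [g fg]]; rewrite (sf_shift HF QP fg).
by rewrite om_mulAC family_self // mul1g.
Qed.

Context (H H' : int -> catM S -> Omega).
Context (HF : shift_family F H).
Context (HF' : shift_family F H').

Lemma family_eq_up k n : (0 < k)%N ->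
  (forall M, Ext_above k M -> H (n - 1)%R M = H' (n - 1)%R M) ->
  forall M, Ext_above k.+1 M -> H n M = H' n M.
Proof.
move=> k0 HH' M DM; have [N [P [NPM /inP_Q QP DP DN]]] := cover_Ext_above k0 DM.
apply: (om_cancel (sf_unit HF QP (n - 1)%R)).
by rewrite (family_shift n HF QP NPM) HH' // HH' // (family_shift n HF' QP NPM).
Qed.

Lemma family_eq_down n : (forall M, Ext_above 1 M -> H n M = H' n M) ->
  forall M, Ext_above 1 M -> H (n - 1)%R M = H' (n - 1)%R M.
Proof.
move=> HH' M DM; have [P [N [MPN PP DN]]] := cat_embed hl hS hreg hr right_bound DM.
(* The value at [P] of index [n - 1] is inverse to that of index [n], so agreement passes down. *)
have QP := inP_Q PP; have eP : H (n - 1)%R P = H' (n - 1)%R P.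
  apply: (om_cancel (sf_unit HF QP n)); rewrite om_mulC family_self //.
  by rewrite (HH' P (inP_Ext_above PP)) om_mulC family_self.
by rewrite -(family_shift n HF QP MPN) -(family_shift n HF' QP MPN) HH' // eP.
Qed.

Lemma family_unique n M : H n M = H' n M.
Proof.
have HC m : forall M, Ext_above 1 M -> H m M = H' m M.
  elim/int_rect: m => [M' DM'|m IHm|m IHm].
  - have C' : pdstar_le M' 1 by apply/pdstar_leP.
    by rewrite (sf_extends HF (CatC C')) (sf_extends HF' (CatC C')).
  - move=> M' DM'; apply: (@family_eq_up 1); rewrite ?intS ?[(1 + _)%R]addrC ?addrK //.
    exact: Ext_above_weak DM'.
  - by rewrite intS opprD addrC; apply: family_eq_down.
suff : Ext_above d.+1 M -> H n M = H' n M by apply; apply: left_bound.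
elim: {1}d n M => [|k IHk] m M'; first exact: HC.
by apply: family_eq_up => // M''; apply: IHk.
Qed.
End Uniqueness.

(** * Existence of the family and conclusion *)

Definition extendF (F : catC S -> Omega) M : Omega :=
  if pselect (pdstar_le M 1) is left h then F (CatC h) else 1.

(** The proof of pd* <= 1 found by [extendF] may differ from the one stored in [M]; proof
    irrelevance identifies the two objects. *)
Lemma extendF_C F (M : catC S) : extendF F M = F M.
Proof.
case: M => M h; rewrite /extendF; case: pselect => // h'.
by rewrite (Prop_irrelevance h' h).
Qed.

(** In the range pd* <= 1, [inQ_pd_le] turns finite pd into pd <= 1, where the axioms on [F]
    apply. *)
Lemma extendF_fitting F : quasi_fitting F -> fitting 1 (extendF F).
Proof.
move=> [Fu Fq Fs].
have toC M (DM : Ext_above 1 M) : exists M' : catC S, catC_obj M' = M.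
  by exists (CatC (proj2 (pdstar_leP M 1) DM)).
split.
- move=> P QP DP; have := inQ_pd_le hl QP DP.
  by have [P' <-] := toC P DP; rewrite extendF_C; apply: Fu.
- move=> A B P QP DP DA DB; have := inQ_pd_le hl QP DP.
  have [P' <-] := toC P DP; have [A' <-] := toC A DA; have [B' <-] := toC B DB.
  by move=> PP [f [g fg]]; rewrite !extendF_C; apply: Fq PP fg.
- move=> P B C QP DP DB DC; have := inQ_pd_le hl QP DP.
  have [P' <-] := toC P DP; have [B' <-] := toC B DB; have [C' <-] := toC C DC.
  by move=> PP [f [g fg]]; rewrite !extendF_C; apply: Fs PP fg.
Qed.

Lemma shiftM_family F : quasi_fitting F -> shift_family F (shiftM (extendF F) d).
Proof.
move=> /extendF_fitting GF.
have HF n : fitting d.+1 (shiftM (extendF F) d n) by apply: iter_up_fitting.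
split.
- move=> [M h]; rewrite shiftM_C ?extendF_C //; last exact/pdstar_leP.
  by rewrite -extendF_C.
- by move=> P QP n; apply: (fitting_unit (HF n)).
- move=> N P M f g QP fg n.
  have NPM : ses N P M by exists f, g.
  have HF' := HF (n - 1)%R; have QU := fitting_unit HF' QP (left_bound P).
  (* Multiplied by the unit F^<n-1>(P), the shift rule becomes the defining equation of a shift up,
     once F^<n>(P) F^<n-1>(P) = 1 is used. *)
  apply: (om_cancel QU); rewrite om_mulAC.
  have D2 M' : Ext_above d.+2 M' by apply: Ext_above_weak (left_bound M').
  rewrite !(shiftM_step GF n (left_bound _)) (shift_upE _ HF' (D2 M) NPM) //.
  by rewrite (shift_up_self _ HF') // mul1g.
- by move=> A B P f g QP fg n; apply: (fitting_quot (HF n)) => //; exists f, g.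
- by move=> P B C f g QP fg n; apply: (fitting_sub (HF n)) => //; exists f, g.
Qed.
End Shift.

Theorem theorem3p20 (R : pzRingType) (S : R -> Prop) (Omega : monoidType)
    (hl : left_noetherian R) (hr : right_noetherian R)
    (hS : ore_set S) (hreg : forall f : R, S f -> non_zero_divisor f)
    (hd : pdstar_bounded R)
    (hOmega : commutative (fun x y : Omega => (x * y)%g))
    (F : catC S -> Omega) (hF : quasi_fitting F) :
  exists! Fn : int -> catM S -> Omega, shift_family F Fn.
Proof.
have [delta [boundL boundR]] := hd.
(* [delta] is an integer, possibly negative; its absolute value is a bound among the natural
   numbers. *)
have bound (T : pzRingType) (M : lmodType T) j :
    pdstar_le M delta -> (`|delta| <= j)%N -> Ext_zeroS j M T^o.
  move=> Md dj; have {}Md : pdstar_le M `|delta|%N.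
    by move=> i /Md /le_trans; apply; rewrite abszE ler_norm.
  exact: (proj1 (pdstar_leP M _) Md).
have right_bound (L : lmodType R^c) : finitely_generated L ->
    Ext_zeroS `|delta|%N L (R^c)^o by move=> /boundR /bound; apply.
(* The successor is the range reached by [|delta|] shifts up that start from pd* <= 1. *)
have left_bound (M : catM S) : Ext_above `|delta|.+1 M.
  by move=> j dj; apply: bound (ltnW dj); apply/boundL/catM_fg.
exists (shiftM (extendF F) `|delta|%N); split; first exact: shiftM_family.
move=> H HF; apply: funext => n; apply: funext => M.
apply: (family_unique hl hr hS hreg right_bound left_bound hOmega _ HF).
exact: shiftM_family.
Qed.
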